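(* Let $p(\cdot), q(\cdot)\in\mathbb{P}_{1}(0,\infty)$ be such that $q(0)\le p(0)$ and $p(\infty)\le q(\infty)$. Then the Köthe dual $\left(\mathfrak{L}^{p(\cdot),q(\cdot)}(\mathbb{R}^n)\right)'$ is isomorphic to the (topological) dual space $\left(\mathfrak{L}^{p(\cdot),q(\cdot)}(\mathbb{R}^n)\right)^{*}$.
   Context: A variable exponent on $(0,\infty)$ is a measurable function $p(\cdot):(0,\infty)\to(0,\infty)$; put $p_{-}=\operatorname{ess\,inf}_{t\in(0,\infty)}p(t)$ and $p_{+}=\operatorname{ess\,sup}_{t\in(0,\infty)}p(t)$. $\mathbb{P}_0(0,\infty)$ is the class of variable exponents with $0<p_{-}\le p_{+}<\infty$ for which the limits $p(0)=\lim_{t\to0^+}p(t)$ and $p(\infty)=\lim_{t\to\infty}p(t)$ exist and, for some constant $C>0$, $|p(t)-p(0)|\le \frac{C}{-\log t}$ for $0<t<\frac12$ and $|p(t)-p(\infty)|\le\frac{C}{\log(e+t)}$ for $0<t<\infty$. $\mathbb{P}_1(0,\infty)$ is the set of $p(\cdot)\in\mathbb{P}_0(0,\infty)$ with $p_{-}>1$. For measurable $f$ on $\mathbb{R}^n$, the non-increasing rearrangement is $f^{*}(t)=\inf\{s\ge 0: |\{x\in\mathbb{R}^n:|f(x)|>s\}|\le t\}$, $0<t<\infty$. Put $\rho_{p(\cdot),q(\cdot)}(f)=\int_0^\infty t^{\frac{q(t)}{p(t)}-1}[f^{*}(t)]^{q(t)}\,dt$. The variable Lorentz space $\mathfrak{L}^{p(\cdot),q(\cdot)}(\mathbb{R}^n)$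 is the set of measurable $f$ with $\rho_{p(\cdot),q(\cdot)}(f)<\infty$, equipped with $\|f\|_{\mathfrak{L}^{p(\cdot),q(\cdot)}}=\inf\{\lambda>0:\rho_{p(\cdot),q(\cdot)}(f/\lambda)\le 1\}$. The Köthe dual $(\mathfrak{L}^{p(\cdot),q(\cdot)}(\mathbb{R}^n))'$ is the space of measurable $f$ on $\mathbb{R}^n$ with $\|f\|_{(\mathfrak{L}^{p(\cdot),q(\cdot)})'}:=\sup\{\|fg\|_{L^1(\mathbb{R}^n)}:\|g\|_{\mathfrak{L}^{p(\cdot),q(\cdot)}}\le 1\}<\infty$. The dual space $(\cdot)^{*}$ is the space of continuous linear functionals. *)

(* Defs.v *)
From HB Require Import structures.
From mathcomp Require Import all_boot all_order all_algebra.
From mathcomp Require Import all_classical all_reals all_analysis ess_sup_inf.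

Set Implicit Arguments.
Unset Strict Implicit.
Unset Printing Implicit Defensive.

Import Order.TTheory GRing.Theory Num.Theory.
Import numFieldNormedType.Exports.

Local Open Scope classical_set_scope.
Local Open Scope ring_scope.

(** * Lebesgue measure on R^n

  The dimension is written n.+1, so that it is at least 1. *)

Section lebesgue_euclidean.
Context {R : realType} {n : nat}.
Implicit Types (a b : 'rV[R]_n.+1) (A : set 'rV[R]_n.+1).

(* A box with some b i <= a i is empty and has volume 0. *)
Definition box a b : set 'rV[R]_n.+1 :=
  [set x | forall i, a ord0 i < x ord0 i <= b ord0 i].

Definition box_volume a b : R :=
  \prod_(i < n.+1) Num.max (b ord0 i - a ord0 i) 0.

Local Open Scope ereal_scope.

Definition box_cover A (c : nat -> 'rV[R]_n.+1 * 'rV[R]_n.+1) : Prop :=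
  A `<=` \bigcup_k box (c k).1 (c k).2.

Definition lebesgue_outer A : \bar R :=
  ereal_inf [set \sum_(k <oo) (box_volume (c k).1 (c k).2)%:E
            | c in box_cover A].

Lemma box_volume_ge0 a b : (0 <= box_volume a b)%R.
Proof. by apply: prodr_ge0 => i _; rewrite le_max lexx orbT. Qed.

Lemma lebesgue_outer_ge0 A : 0 <= lebesgue_outer A.
Proof.
apply: le_ereal_inf_tmp => _ [c _ <-]; apply: nneseries_ge0 => k _ _.
by rewrite lee_fin box_volume_ge0.
Qed.

Lemma lebesgue_outer0 : lebesgue_outer set0 = 0.
Proof.
apply/eqP; rewrite eq_le lebesgue_outer_ge0 andbT.
apply: ereal_inf_lbound; exists (fun=> (0, 0)%R); first by [].
apply: eseries0 => k _ _; rewrite /box_volume (bigD1 ord0)//=.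
by rewrite subrr maxxx mul0r.
Qed.

Lemma le_lebesgue_outer :
  {homo lebesgue_outer : A B / A `<=` B >-> A <= B}.
Proof.
move=> A B AB; apply: ereal_inf_le_tmp => _ [c Bc <-].
by exists c => //; exact: subset_trans AB Bc.
Qed.

Lemma lebesgue_outer_sigma_subadditive : sigma_subadditive lebesgue_outer.
Proof.
pose v (c : 'rV[R]_n.+1 * 'rV[R]_n.+1) : \bar R := (box_volume c.1 c.2)%:E.
have v0 c : 0 <= v c by rewrite lee_fin box_volume_ge0.
move=> A; have [[i ioo]|] := pselect (exists i, lebesgue_outer (A i) = +oo).
  rewrite (eseries_pinfty _ _ ioo) ?leey// => k _.
  by rewrite -ltNye (lt_le_trans _ (lebesgue_outer_ge0 _)).
rewrite -forallNE => Aoo; apply/lee_addgt0Pr => _/posnumP[e].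
rewrite (le_trans _ (epsilon_trick _ _ _))//; last first.
  by move=> k; exact: lebesgue_outer_ge0.
pose P k c := box_cover (A k) c /\
  \sum_(j <oo) v (c j) <=
    lebesgue_outer (A k) + (e%:num / (2 ^ k.+1)%:R)%:E.
have [G PG] : {G & forall k, P k (G k)}.
  apply: (@choice _ _ P) => k; rewrite /P.
  have fk : lebesgue_outer (A k) \is a fin_num.
    by rewrite ge0_fin_numE ?lebesgue_outer_ge0// ltey; apply/eqP/Aoo.
  have ek : (0 < e%:num / (2 ^ k.+1)%:R :> R)%R by [].
  have [_ [c Ac <-] cE] := lb_ereal_inf_adherent ek fk.
  by exists c; split => //; exact: ltW.
apply: (@le_trans _ _ (\esum_(i in setT) (v \o uncurry G) i)).
  apply: ereal_inf_lbound => /=.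
  have /card_esym/ppcard_eqP[f] := card_nat2.
  exists (uncurry G \o f).
    move=> t [i _ /((PG i).1 t)[j _ Gt]].
    by exists (f^-1%FUN (i, j)) => //=; rewrite invK ?inE.
  rewrite -(esum_pred_image (v \o uncurry G) _ xpredT) ?[fun=> _]set_true//.
    by rewrite image_eq.
  by move=> i _; exact: v0.
rewrite (_ : esum _ _ = \sum_(i <oo) \sum_(j <oo) v (G i j)); last first.
  pose J : nat -> set (nat * nat) := fun i => [set (i, j) | j in setT].
  rewrite (_ : setT = \bigcup_k J k); last first.
    by rewrite predeqE => -[a b]; split => // _; exists a => //; exists b.
  rewrite esum_bigcupT /=; last 2 first.
    - apply/trivIsetP => i j _ _ ij.
      rewrite predeqE => -[k m] /=; split => //= -[] [_] _ [<-{k} _].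
      by move=> [m' _] [] /esym/eqP; rewrite (negbTE ij).
    - by move=> i; exact: v0.
  rewrite -(image_id [set: nat]) -fun_true esum_pred_image//; last first.
    by move=> k _; apply: esum_ge0 => i _; exact: v0.
  apply: eq_eseriesr => /= j _.
  rewrite -(esum_pred_image (v \o uncurry G) (pair j) predT)//=; last first.
    by move=> ? ? _ _; exact: (@can_inj _ _ _ snd).
  by congr esum; rewrite predeqE => -[a b]; split; move=> [i _ <-]; exists i.
apply: lee_lim.
- by apply: is_cvg_nneseries => k _ _; apply: nneseries_ge0 => m _ _; exact: v0.
- by apply: is_cvg_nneseries => k _ _; apply: adde_ge0 => //;
    exact: lebesgue_outer_ge0.
- by near=> k; apply: lee_sum => i _; exact: (PG i).2.
Unshelve. all: by end_near. Qed.

HB.instance Definition _ := isOuterMeasure.Build R 'rV[R]_n.+1 lebesgue_outer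
  lebesgue_outer0 lebesgue_outer_ge0 le_lebesgue_outer
  lebesgue_outer_sigma_subadditive.

End lebesgue_euclidean.

(* R^(n+1) with the sigma-algebra of its Lebesgue measurable sets. *)
Definition euclid (R : realType) (n : nat) :=
  caratheodory_type (@lebesgue_outer R n).
HB.instance Definition _ R n := Measurable.on (euclid R n).

Definition lebesgue_euclid (R : realType) (n : nat) :
  set (euclid R n) -> \bar R := @lebesgue_outer R n.
HB.instance Definition _ R n := isMeasure.Build _ (euclid R n) R
  (@lebesgue_euclid R n)
  (@caratheodory_measure0 _ _ (@lebesgue_outer R n))
  (@caratheodory_measure_ge0 _ _ (@lebesgue_outer R n))
  (@caratheodory_measure_sigma_additive _ _ (@lebesgue_outer R n)).

(* The real line with the sigma-algebra of its Lebesgue measurable sets, on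
   which [completed_lebesgue_measure] is defined. *)
Notation lebesgue_line R := (caratheodory_type (wlength (@idfun R))^*%mu).

Lemma measurable_pos (R : realType) :
  measurable (`]0, +oo[%classic : set (lebesgue_line R)).
Proof.
apply: sub_caratheodory.
exact: (measurable_itv (`]0, +oo[ : interval R)).
Qed.

(** * Variable exponents on (0, oo)

  An exponent is a function on the whole line of which only the values on
  (0, oo) matter; [exponent0 p] and [exponenty p] are the limits p(0) and
  p(oo), not values of p. *)

Section exponents.
Context {R : realType}.
Implicit Types p : R -> R.

Definition variable_exponent p : Prop :=
  measurable_fun (`]0, +oo[%classic : set (lebesgue_line R))
    (p : lebesgue_line R -> R) /\
  forall t : R, 0 < t -> 0 < p t.

Local Notation lambda_pos :=
  (mrestr (@completed_lebesgue_measure R) (@measurable_pos R)).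

Definition exponent_inf p : \bar R := ess_inf lambda_pos (EFin \o p).

Definition exponent_sup p : \bar R := ess_sup lambda_pos (EFin \o p).

Definition exponent0 p : R := lim (p t @[t --> 0^'+]).

Definition exponenty p : R := lim (p t @[t --> +oo]).

Definition exponentP0 p : Prop :=
  [/\ variable_exponent p,
      [/\ (0 < exponent_inf p)%E, (exponent_inf p <= exponent_sup p)%E
        & (exponent_sup p < +oo)%E],
      cvg (p t @[t --> 0^'+]),
      cvg (p t @[t --> +oo])
    & exists2 C : R, 0 < C &
        (forall t : R, 0 < t < 2^-1 -> `|p t - exponent0 p| <= C / - ln t) /\
        (forall t : R, 0 < t -> `|p t - exponenty p| <= C / ln (expR 1 + t))].

Definition exponentP1 p : Prop := exponentP0 p /\ (1 < exponent_inf p)%E.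

End exponents.

(** * The variable Lorentz space, its Koethe dual and its topological dual

  Functions are real-valued and spaces are sets of functions rather than of
  classes modulo almost everywhere equality. *)

Section lorentz.
Context {R : realType} {n : nat}.
Local Notation X := (euclid R n).
Local Notation mu := (@lebesgue_euclid R n).
Implicit Types (p q : R -> R) (f g h : X -> R) (L : (X -> R) -> R).
Local Open Scope ereal_scope.

Definition rearrangement f (t : R) : \bar R :=
  ereal_inf [set s%:E | s in
    [set s : R | (0 <= s)%R /\ mu [set x | (s < `|f x|)%R] <= t%:E]].

Definition lorentz_modular p q f : \bar R :=
  \int[@completed_lebesgue_measure R]_(t in `]0%R, +oo[%classic)
    ((t `^ (q t / p t - 1))%:E * rearrangement f t `^ q t).

Definition lorentz p q : set (X -> R) :=
  [set f | measurable_fun setT f /\ lorentz_modular p q f < +oo].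

Definition lorentz_norm p q f : \bar R :=
  ereal_inf [set l%:E | l in
    [set l : R | (0 < l)%R /\ lorentz_modular p q (fun x => f x / l)%R <= 1]].

Definition koethe_norm p q f : \bar R :=
  ereal_sup [set 'N[mu]_1[EFin \o (f \* g)%R] | g in
    [set g | lorentz p q g /\ lorentz_norm p q g <= 1]].

Definition koethe_dual p q : set (X -> R) :=
  [set f | measurable_fun setT f /\ koethe_norm p q f < +oo].

(* Functionals are total on functions; only their values on the Lorentz space
   matter. *)
Definition linear_on (V : set (X -> R)) L : Prop :=
  forall (a : R) f g, V f -> V g ->
    L (fun x => a * f x + g x)%R = (a * L f + L g)%R.

Definition lorentz_continuous p q L : Prop :=
  forall f, lorentz p q f -> forall e : R, (0 < e)%R ->
    exists2 d : R, (0 < d)%R &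
      forall g, lorentz p q g ->
        lorentz_norm p q (fun x => g x - f x)%R < d%:E ->
        (`|L g - L f| < e)%R.

Definition topological_dual p q : set ((X -> R) -> R) :=
  [set L | linear_on (lorentz p q) L /\ lorentz_continuous p q L].

Definition dual_norm p q L : \bar R :=
  ereal_sup [set `|L f|%:E | f in
    [set f | lorentz p q f /\ lorentz_norm p q f <= 1]].

(* Linear homeomorphism of the normed spaces of the Koethe dual modulo almost
   everywhere equality and of the topological dual modulo equality on the
   Lorentz space. *)
Record koethe_dual_isomorphism p q (T : (X -> R) -> ((X -> R) -> R)) : Prop := {
  iso_dual : forall g, koethe_dual p q g -> topological_dual p q (T g) ;
  iso_linear : forall (a : R) g h, koethe_dual p q g -> koethe_dual p q h ->
    forall f, lorentz p q f ->
      T (fun x => a * g x + h x)%R f = (a * T g f + T h f)%R ;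
  iso_inj : forall g h, koethe_dual p q g -> koethe_dual p q h ->
    (forall f, lorentz p q f -> T g f = T h f) <-> g = h %[ae mu] ;
  iso_surj : forall L, topological_dual p q L ->
    exists2 g, koethe_dual p q g & forall f, lorentz p q f -> T g f = L f ;
  iso_bounded : exists2 C : R, (0 < C)%R & forall g, koethe_dual p q g ->
    dual_norm p q (T g) <= C%:E * koethe_norm p q g ;
  iso_inv_bounded : exists2 C : R, (0 < C)%R & forall g, koethe_dual p q g ->
    koethe_norm p q g <= C%:E * dual_norm p q (T g) }.

End lorentz.

(* Main.v *)
(* The isomorphism is g |-> (f |-> \int f g). Multiplying f by a sign shows
   that it is isometric, and it is injective because the Lorentz space contains
   an everywhere positive function w, whose rearrangement is at most
   (1 + t)^-2.

   For surjectivity the key is order continuity: if |f_k| <= |f| with f in the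
   space and f_k -> 0 pointwise, then the level sets of f have finite measure, so
   the rearrangements of the f_k tend to 0 and, by dominated convergence, so do
   the modulars. Hence E |-> L (w 1_E) is a finite charge, absolutely continuous
   with respect to Lebesgue measure. If h is its Radon-Nikodym density, then
   L f = \int f (h / w) holds for w times a simple function, and extends to
   f >= 0 by monotone approximation; using L (f sgn h), monotone convergence
   shows that f h / w is integrable. *)
Require Import Defs.
From HB Require Import structures.
From mathcomp Require Import all_boot all_order all_algebra.
From mathcomp Require Import all_classical all_reals all_analysis ess_sup_inf.
From mathcomp Require Import measurable_realfun ring lra.
Import Order.TTheory GRing.Theory Num.Theory.
Import numFieldNormedType.Exports.
Local Open Scope classical_set_scope.
Local Open Scope ring_scope.
Set Implicit Arguments.
Unset Strict Implicit.
Unset Printing Implicit Defensive.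

(** * Cubes and sigma-finiteness *)

(** Since [q] varies, the modular is not homogeneous: scaling a function by c multiplies its
    integrand by c^q(t). The estimates are therefore made on modulars, through pointwise domination:
    |f| <= c |g| passes to rearrangements and then, as q lies between 1 and some Q almost
    everywhere, to modulars with a constant factor. A strict bound on the norm is used in the form
    of an l for which the modular of f / l is at most 1. Both underlying measures come from
    Caratheodory's construction. On R^(n+1), measurability of boxes and then sigma-finiteness, which
    Radon-Nikodym requires, are obtained by cutting boxes along hyperplanes. On the line, exponents
    are only Lebesgue measurable, so modulars are integrals for the completed measure, and the
    calculus of Borel functions is carried over to it. *)

Section cubes.
Context {R : realType} {n : nat}.
Local Notation X := (euclid R n).
Local Notation mu := (@lebesgue_euclid R n).

Let upd (a : 'rV[R]_n.+1) (i : 'I_n.+1) (c : R) : 'rV[R]_n.+1 :=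
  \row_j (if j == i then c else a ord0 j).

(** The hyperplane x_i = c changes the i-th factor only. Truncation of the factors at 0 keeps the
    identity true when c lies outside the i-th side or when that side is empty. *)
Lemma box_volume_split (a b : 'rV[R]_n.+1) (i : 'I_n.+1) (c : R) :
  box_volume a b = box_volume a (upd b i (Num.min (b ord0 i) c)) +
                   box_volume (upd a i (Num.max (a ord0 i) c)) b.
Proof.
rewrite /box_volume !(bigD1 i (P := predT)) //= !mxE eqxx.
set P := \prod_(_ < _ | _) _.
rewrite (_ : \prod_(_ < _ | _) _ = P); last first.
  by apply: eq_bigr => j ji; rewrite !mxE (negbTE ji).
rewrite [X in _ + _ * X](_ : _ = P); last first.
  by apply: eq_bigr => j ji; rewrite !mxE (negbTE ji).
rewrite -mulrDl; congr (_ * _).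
rewrite /Num.max /Num.min.
by repeat case: ifPn; rewrite -?leNgt => *; lra.
Qed.

Lemma lebesgue_outer_box (a b : 'rV[R]_n.+1) :
  (lebesgue_outer (box a b) <= (box_volume a b)%:E)%E.
Proof.
apply: ereal_inf_lbound; exists (fun k : nat => if k == 0%N then (a, b) else (0, 0)).
  by move=> x abx; exists 0%N.
rewrite (@nneseries_split _ _ 0%N 1) ?add0n; last first.
  by move=> k _; rewrite lee_fin box_volume_ge0.
rewrite big_nat1 eseries0 ?adde0// => -[//|k] _ _ /=.
by rewrite /box_volume (bigD1 ord0)//= subrr maxxx mul0r.
Qed.

(** Caratheodory's criterion: cutting each box of a cover of A along the hyperplane yields covers of
    the two parts of A, with the same total volume. *)
Lemma measurable_halfspace (i : 'I_n.+1) (c : R) :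
  measurable ([set x | x ord0 i <= c] : set X).
Proof.
apply: le_caratheodory_measurable => A; apply: le_ereal_inf_tmp => _ [k Ak <-].
pose k1 j := ((k j).1, upd (k j).2 i (Num.min ((k j).2 ord0 i) c)).
pose k2 j := (upd (k j).1 i (Num.max ((k j).1 ord0 i) c), (k j).2).
under eq_eseriesr do rewrite (box_volume_split _ _ i c) EFinD.
rewrite nneseriesD; [|by move=> j _ _; rewrite lee_fin box_volume_ge0..].
apply: leeD; apply: ereal_inf_lbound.
- exists k1 => // x [/Ak[j _ jx] /= xc]; exists j => // l.
  have := jx l; rewrite mxE; case: ifP => [/eqP ->|//].
  by rewrite le_min xc => /andP[-> ->].
- exists k2 => // x [/Ak[j _ jx] /= xc]; exists j => // l.
  have := jx l; rewrite mxE; case: ifP => [/eqP ->|//].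
  by rewrite gt_max (_ : c < _) ?ltNge ?andbT//; apply/negP.
Qed.

Lemma measurable_box (a b : 'rV[R]_n.+1) : measurable (box a b : set X).
Proof.
rewrite (_ : box a b = \bigcap_(i in [set: 'I_n.+1])
   ([set x : X | x ord0 i <= b ord0 i] `\` [set x : X | x ord0 i <= a ord0 i])).
  apply: fin_bigcap_measurable => // i _.
  by apply: measurableD; exact: measurable_halfspace.
apply/seteqP; split => [x abx i _|x abx i] /=.
  by have /andP[ax ->] := abx i; split => //; apply/negP; rewrite -ltNge.
by have [/= -> /negP] := abx i I; rewrite -ltNge => ->.
Qed.

Definition cube (k : nat) : set X := box (const_mx (- k%:R)) (const_mx k%:R).

Lemma measurable_cube k : measurable (cube k).
Proof. exact: measurable_box. Qed.

Lemma cube_lty k : (mu (cube k) < +oo)%E.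
Proof. exact: le_lt_trans (lebesgue_outer_box _ _) (ltry _). Qed.

Lemma subset_cube j k : (j <= k)%N -> cube j `<=` cube k.
Proof.
move=> jk x jx i; have := jx i; rewrite !mxE => /andP[x1 x2].
have jk' : (j%:R : R) <= k%:R by rewrite ler_nat.
by rewrite (le_lt_trans _ x1) ?lerN2// (le_trans x2).
Qed.

Lemma cube_exhaust (x : X) : exists k, cube k x.
Proof.
exists (Num.bound (\sum_i `|x ord0 i|)) => i; rewrite !mxE.
have : `|x ord0 i| < (Num.bound (\sum_i `|x ord0 i|))%:R.
  apply: le_lt_trans (archi_boundP _); last exact: sumr_ge0.
  by rewrite (bigD1 i)//= lerDl sumr_ge0.
by rewrite ltr_norml => /andP[-> /ltW].
Qed.

(** Needed for the Radon-Nikodym derivative with respect to [mu]. *)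
Lemma lebesgue_euclid_sigma_finite : sigma_finite setT mu.
Proof.
exists cube; last by move=> k; split; [exact: measurable_cube|exact: cube_lty].
by apply/seteqP; split => // x _; have [k kx] := cube_exhaust x; exists k.
Qed.

End cubes.

HB.instance Definition _ (R : realType) (n : nat) :=
  @Measure_isSigmaFinite.Build _ (euclid R n) R (@lebesgue_euclid R n)
    (@lebesgue_euclid_sigma_finite R n).

(** * Rearrangements *)

Section rearrangement.
Context {R : realType} {n : nat}.
Local Notation X := (euclid R n).
Local Notation mu := (@lebesgue_euclid R n).
Implicit Types (f g : X -> R) (s t c : R).
Local Open Scope ereal_scope.

Lemma rearrangement_ge0 f t : 0 <= rearrangement f t.
Proof. by apply: le_ereal_inf_tmp => _ [s [s0 _] <-]; rewrite lee_fin. Qed.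

Lemma rearrangement_le f t s : (0 <= s)%R ->
  mu [set x | (s < `|f x|)%R] <= t%:E -> rearrangement f t <= s%:E.
Proof. by move=> s0 fs; apply: ereal_inf_lbound; exists s. Qed.

(** A level admissible in the infimum has a super-level set of finite measure, so it cannot lie
    below s. *)
Lemma rearrangement_ge f t s :
  mu [set x | (s < `|f x|)%R] = +oo -> s%:E <= rearrangement f t.
Proof.
move=> fs; apply: le_ereal_inf_tmp => _ [r [r0 fr] <-].
rewrite lee_fin leNgt; apply/negP => rs.
have : mu [set x | (s < `|f x|)%R] <= mu [set x | (r < `|f x|)%R].
  by apply: le_lebesgue_outer => x /=; exact: lt_trans.
by rewrite fs leye_eq => /eqP fr'; move: fr; rewrite fr' leye_eq.
Qed.

Lemma le_rearrangementZ c f g t : (0 < c)%R ->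
  (forall x, `|f x| <= c * `|g x|)%R ->
  rearrangement f t <= c%:E * rearrangement g t.
Proof.
move=> c0 fg; rewrite muleC -lee_pdivrMr//.
apply: le_ereal_inf_tmp => _ [r [r0 gr] <-].
rewrite lee_pdivrMr// -EFinM; apply: rearrangement_le.
  by rewrite mulr_ge0// ltW.
apply: le_trans gr; apply: le_lebesgue_outer => x /=.
by move=> /lt_le_trans/(_ (fg x)); rewrite mulrC ltr_pM2l.
Qed.

Lemma le_rearrangement f g t : (forall x, `|f x| <= `|g x|)%R ->
  rearrangement f t <= rearrangement g t.
Proof.
move=> fg; rewrite -[leRHS]mul1e; apply: le_rearrangementZ => // x.
by rewrite mul1r.
Qed.

Lemma rearrangement_nonincreasing f s t : (s <= t)%R ->
  rearrangement f t <= rearrangement f s.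
Proof.
move=> st; apply: ereal_inf_le_tmp => _ [r [r0 rs] <-]; exists r => //.
by split => //; rewrite (le_trans rs)// lee_fin.
Qed.

End rearrangement.

(** * From Borel functions to the completed Lebesgue measure *)

Section lebesgue_line.
Context {R : realType}.
Local Notation lam := (@completed_lebesgue_measure R).
Implicit Types D : set R.

Lemma measurable_line D : measurable D -> measurable (D : set (lebesgue_line R)).
Proof. by move=> mD; apply: sub_caratheodory. Qed.

Lemma measurable_fun_line d (T : measurableType d) D (f : R -> T) :
  measurable D -> measurable_fun D f ->
  measurable_fun (D : set (lebesgue_line R)) f.
Proof. by move=> mD mf _ Y mY; apply: measurable_line; exact: mf. Qed.

(** The identity is measurable from the Lebesgue to the Borel sigma-algebra, and [lebesgue_measure]
    is the image of the completed measure under it. This gives access to the fundamental theorem of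
    calculus. *)
Lemma ge0_integral_line D (f : R -> \bar R) : measurable D ->
  measurable_fun D f -> (forall x, D x -> 0 <= f x)%E ->
  (\int[lam]_(x in D) f x = \int[lebesgue_measure]_(x in D) f x)%E.
Proof.
move=> mD mf f0.
have mid : measurable_fun [set: lebesgue_line R]
    (idfun : lebesgue_line R -> measurableTypeR R).
  by move=> _ Y mY; rewrite setTI; exact: measurable_line.
rewrite -(ge0_integral_pushforward mid lam mD mf)//.
by move=> x; rewrite inE; exact: f0.
Qed.

Lemma measurable_fun_poweR d (T : measurableType d) (D : set T)
    (f : T -> \bar R) (r : T -> R) : measurable D ->
  measurable_fun D f -> measurable_fun D r ->
  (forall x, D x -> 0 <= f x)%E -> (forall x, D x -> 0 < r x) ->
  measurable_fun D (fun x => f x `^ r x)%E.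
Proof.
move=> mD mf mr f0 r0.
(* With a positive exponent, 0 and +oo are fixed by the power; elsewhere it is expR (r ln f), a
   composition of measurable functions. *)
pose g x := (if f x == +oo then +oo else if f x == 0 then 0 else
             (expR (r x * ln (fine (f x))))%:E)%E.
apply: (eq_measurable_fun g) => [x|]; first rewrite inE => Dx.
  have := f0 x Dx; have := r0 x Dx; rewrite /g; case: (f x) => [y| |]//= ry y0.
  - by rewrite eqe /powR; case: ifPn => // _; rewrite (gt_eqF ry).
  - by rewrite (gt_eqF ry).
have mE (a : \bar R) : measurable_fun D (fun x => f x == a).
  by apply: measurable_fun_eqe.
apply: measurable_fun_if => //.
have mD' : measurable (D `&` (fun x => f x == +oo%E) @^-1` [set false]).
  exact: mE.
apply: measurable_fun_if => //.
- by apply: measurable_funS (mE 0%E) => //; exact: subIset.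
- apply/measurable_EFinP; apply: measurableT_comp => //.
  apply: measurable_funM.
    by apply: measurable_funS mr => // x [[]].
  apply: measurableT_comp => //.
  apply: measurableT_comp => //.
  by apply: measurable_funS mf => // x [[]].
Qed.

End lebesgue_line.

(** * Power integrals and bounds on the exponents *)

Section power_integrals.
Context {R : realType}.
Local Notation lam := (@completed_lebesgue_measure R).
Implicit Types a b r : R.

Lemma continuous_powR_pos r (x : R) : 0 < x ->
  {for x, continuous (fun x : R => x `^ r)}.
Proof.
move=> x0; apply: differentiable_continuous; apply/derivable1_diffP.
by apply: derivable_powR; rewrite in_itv/= x0.
Qed.

Lemma integral_powR a b r : 0 < a -> a < b -> r != 0 ->
  (\int[lam]_(t in `[a, b]) (t `^ (r - 1))%:E = ((b `^ r - a `^ r) / r)%:E)%E.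
Proof.
move=> a0 ab r0.
have c0 s x : a <= x -> {for x, continuous (fun x : R => x `^ s)}.
  by move=> ax; apply: continuous_powR_pos; exact: lt_le_trans ax.
have cw s : {within `[a, b], continuous (fun x : R => x `^ s)}.
  apply: continuous_in_subspaceT => x; rewrite inE/= in_itv/= => /andP[ax _].
  exact: c0.
rewrite ge0_integral_line//; last 2 first.
- apply/measurable_EFinP; exact: measurable_funTS.
- by move=> x _; rewrite lee_fin powR_ge0.
rewrite (@continuous_FTC2 _ _ (fun x => r^-1 * x `^ r))//.
- by rewrite -EFinB -mulrBr mulrC.
- have cF x : a <= x -> {for x, continuous (fun x : R => r^-1 * x `^ r)}.
    by move=> ax; apply: continuousM; [exact: cst_continuous|exact: c0].
  split => [x||].
  + rewrite in_itv/= => /andP[ax _]; apply: derivableM => //.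
    by apply: derivable_powR; rewrite in_itv/= (lt_trans a0).
  + by apply: cvg_at_right_filter; exact: cF.
  + by apply: cvg_at_left_filter; apply: cF; exact: ltW.
- move=> x; rewrite in_itv/= => /andP[ax _].
  have x0 := lt_trans a0 ax.
  rewrite derive1E deriveM//; last first.
    by apply: derivable_powR; rewrite in_itv/= x0.
  rewrite derive_cst scaler0 addr0 -derive1E powR_derive1 ?in_itv/= ?x0//.
  by rewrite /GRing.scale/= mulrA mulVf// mul1r.
Qed.

(** Reduces improper integrals to compact intervals: a uniform bound passes to the increasing union
    by monotone convergence. *)
Lemma integral_bigcup_itv_le (F : nat -> set R) (h : R -> R) (M : \bar R) :
  (forall k, measurable (F k)) -> (forall k, F k `<=` F k.+1) ->
  measurable_fun setT h -> (forall x, 0 <= h x) ->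
  (forall k, \int[lam]_(t in F k) (h t)%:E <= M)%E ->
  (\int[lam]_(t in \bigcup_k F k) (h t)%:E <= M)%E.
Proof.
move=> mF ndF mh h0 FM.
have ndF' : {homo F : n m / (n <= m)%N >-> (n <= m)%O}.
  by apply/nondecreasing_seqP => k; apply/subsetPset; exact: ndF.
have mh' : measurable_fun (setT : set (lebesgue_line R)) (fun t => (h t)%:E).
  by apply/measurable_EFinP; exact: measurable_fun_line.
have cvgF := @ge0_nondecreasing_set_cvg_integral _ (lebesgue_line R) R F
  (fun t : R => (h t)%:E) lam ndF' (fun k => measurable_line (mF k))
  (fun k => measurable_funTS mh') (fun k x _ => h0 x).
rewrite -(cvg_lim _ cvgF)//; apply: lime_le; first exact: cvgP cvgF.
by apply: nearW => k; exact: FM.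
Qed.

Lemma integral_powR_near0 r : 0 < r ->
  (\int[lam]_(t in `]0%R, 1%R]) (t `^ (r - 1))%:E <= (r^-1)%:E)%E.
Proof.
move=> r0.
(* The shift by 2 keeps the left endpoint strictly below 1, as [integral_powR] requires. *)
pose F (k : nat) : set R := `[k.+2%:R^-1, 1%R]%classic.
have FE : `]0%R, 1%R]%classic = \bigcup_k F k.
  apply/seteqP; split => [x|x [k _]].
    rewrite /= in_itv/= => /andP[x0 x1].
    exists (Num.bound x^-1) => //; rewrite /F/= in_itv/= x1 andbT.
    rewrite invf_ple ?posrE//; apply: ltW.
    apply: (lt_le_trans (archi_boundP _)); first by rewrite invr_ge0 ltW.
    by rewrite ler_nat (leq_trans (leqnSn _)).
  rewrite /F/= !in_itv/= => /andP[kx ->]; rewrite andbT.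
  by rewrite (lt_le_trans _ kx).
rewrite FE; apply: integral_bigcup_itv_le.
- by move=> k; exact: measurable_itv.
- move=> k x; rewrite /F/= !in_itv/= => /andP[kx ->]; rewrite andbT.
  by rewrite (le_trans _ kx)// lef_pV2 ?posrE// ler_nat.
- exact: measurable_powR.
- by move=> x; exact: powR_ge0.
- move=> k; rewrite integral_powR ?gt_eqF//; last by rewrite invf_lt1// ltr1n.
  by rewrite lee_fin powR1 ler_pdivrMr// mulVf ?gt_eqF// gerBl powR_ge0.
Qed.

Lemma integral_powR_nearoo r : 0 < r ->
  (\int[lam]_(t in `[1%R, +oo[) (t `^ (- r - 1))%:E <= (r^-1)%:E)%E.
Proof.
move=> r0.
pose F (k : nat) : set R := `[1%R, k.+2%:R]%classic.
have FE : `[1%R, +oo[%classic = \bigcup_k F k.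
  apply/seteqP; split => [x|x [k _]].
    rewrite /= in_itv/= andbT => x1.
    exists (Num.bound x) => //; rewrite /F/= in_itv/= x1/=; apply: ltW.
    apply: (lt_le_trans (archi_boundP _)); first by rewrite (le_trans _ x1).
    by rewrite ler_nat (leq_trans (leqnSn _)).
  by rewrite /F/= !in_itv/= => /andP[->].
rewrite FE; apply: integral_bigcup_itv_le.
- by move=> k; exact: measurable_itv.
- move=> k x; rewrite /F/= !in_itv/= => /andP[-> kx]/=.
  by rewrite (le_trans kx)// ler_nat.
- exact: measurable_powR.
- by move=> x; exact: powR_ge0.
- move=> k; rewrite integral_powR ?oppr_eq0 ?gt_eqF//; last by rewrite ltr1n.
  rewrite lee_fin powR1 invrN mulrN -mulNr opprB.
  by rewrite ler_pdivrMr// mulVf ?gt_eqF// gerBl powR_ge0.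
Qed.

End power_integrals.

(** * Almost everywhere bounds on the exponents *)

Section exponents.
Context {R : realType}.
Local Notation lam := (@completed_lebesgue_measure R).
Implicit Types p : R -> R.

#[global] Instance completed_lebesgue_ae_filter :
  Filter (nbhs (almost_everywhere lam)).
Proof. exact: (@ae_filter_ringOfSetsType _ (lebesgue_line R) R lam). Qed.

Lemma ae_mrestr (P : R -> Prop) :
  (\forall t \ae mrestr lam (@measurable_pos R), P t) ->
  \forall t \ae lam, 0 < t -> P t.
Proof.
move=> [A [mA A0 PA]]; exists (A `&` `]0, +oo[%classic); split => //.
  by apply: measurableI => //; exact: measurable_pos.
move=> t /= /not_implyP[t0 Pt]; split; last by rewrite /= in_itv/= t0.
exact: PA.
Qed.

(** The bounds come from an essential infimum and supremum and hold only almost everywhere; this is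
    why modulars are compared below under almost everywhere hypotheses. *)
Lemma exponent_bounds p : exponentP1 p ->
  exists P, \forall t \ae lam, 0 < t -> 1 <= p t <= P.
Proof.
move=> [[_ [_ infsup suplty] _ _ _] inf1].
have supgt := lt_le_trans inf1 infsup.
have supfin : exponent_sup p \is a fin_num.
  by rewrite fin_numE -ltNye -ltey suplty (lt_trans (ltNyr 1)).
exists (fine (exponent_sup p)).
have /ae_mrestr := ess_inf_le (mrestr lam (@measurable_pos R)) (EFin \o p).
have /ae_mrestr := ess_sup_ge (mrestr lam (@measurable_pos R)) (EFin \o p).
apply: filterS2 => t sup inf t0; rewrite -!lee_fin fineK// sup// andbT.
exact: le_trans (ltW inf1) (inf t0).
Qed.

End exponents.

(** * The modular *)

Section modular.
Context {R : realType} {n : nat} (p q : R -> R).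
Hypotheses (hp : exponentP1 p) (hq : exponentP1 q).
Local Notation X := (euclid R n).
Local Notation mu := (@lebesgue_euclid R n).
Local Notation lam := (@completed_lebesgue_measure R).
Local Notation D := (`]0%R, +oo[%classic : set (lebesgue_line R)).
Implicit Types (f g : X -> R) (s t c : R).

(** By monotonicity, the sets where the rearrangement exceeds a level are intervals. *)
Lemma measurable_rearrangement f :
  measurable_fun D (rearrangement f : lebesgue_line R -> \bar R).
Proof.
apply: measurable_fun_line; first exact: measurable_itv.
move=> mD; apply: (measurability _ (ErealGenOInfty.measurableE R)) => //.
move=> _ [_ [r ->] <-]; apply: is_interval_measurable => s t /=.
rewrite !in_itv/= !andbT => -[s0 _] [t0 rt] u /andP[su ut].
rewrite !in_itv/= !andbT; split; first by rewrite (lt_le_trans s0).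
apply: (lt_le_trans rt); exact: rearrangement_nonincreasing.
Qed.

Lemma exponent_gt0 (r : R -> R) : exponentP1 r -> forall t, 0 < t -> 0 < r t.
Proof. by move=> [[[]]]. Qed.

Lemma measurable_exponent (r : R -> R) : exponentP1 r ->
  measurable_fun D (r : lebesgue_line R -> R).
Proof. by move=> [[[]]]. Qed.

Definition modular_integrand f (t : R) : \bar R :=
  ((t `^ (q t / p t - 1))%:E * rearrangement f t `^ q t)%E.

Lemma modular_integrand_ge0 f t : (0 <= modular_integrand f t)%E.
Proof. by apply: mule_ge0; rewrite ?lee_fin ?powR_ge0// poweR_ge0. Qed.

Lemma measurable_modular_integrand f :
  measurable_fun D (modular_integrand f : lebesgue_line R -> \bar R).
Proof.
have mlnR : measurable_fun D (@ln R : lebesgue_line R -> R).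
  apply: measurable_fun_line; first exact: measurable_itv.
  by apply: measurable_funTS; exact: measurable_ln.
have mexp : measurable_fun [set: R] (@expR R) by exact: measurable_expR.
have mp := measurable_exponent hp; have mq := measurable_exponent hq.
(* The reciprocal is written as a power and t^r as expR (r ln t), to compose measurable functions;
   on (0, oo), where t and p(t) are positive, nothing changes. *)
have mpV : measurable_fun D (fun t : lebesgue_line R => p t `^ (-1)).
  exact: (measurableT_comp (measurable_powR (-1)) mp).
have mr : measurable_fun D (fun t : lebesgue_line R => q t * p t `^ (-1) - 1).
  by apply: measurable_funB; [exact: measurable_funM|exact: measurable_cst].
have me : measurable_fun D
    (fun t : lebesgue_line R => expR ((q t * p t `^ (-1) - 1) * ln t)).
  exact: (measurableT_comp mexp (measurable_funM mr mlnR)).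
apply: emeasurable_funM.
  apply/measurable_EFinP; apply: eq_measurable_fun me => t.
  rewrite inE/= in_itv/= andbT => t0; rewrite [RHS]/powR gt_eqF//.
  by rewrite powR_inv1// ltW// exponent_gt0.
apply: measurable_fun_poweR => //.
- exact: measurable_pos.
- exact: measurable_rearrangement.
- by move=> t _; exact: rearrangement_ge0.
- by move=> t; rewrite /= in_itv/= andbT; exact: exponent_gt0.
Qed.

(** * Comparison of modulars *)

Lemma le_modular_ae (K : R) f g : 0 <= K ->
  (\forall t \ae lam, 0 < t ->
    (rearrangement f t `^ q t <= K%:E * rearrangement g t `^ q t)%E) ->
  (lorentz_modular p q f <= K%:E * lorentz_modular p q g)%E.
Proof.
move=> K0 fg.
have mD := @measurable_pos R.
have mg := measurable_modular_integrand g.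
rewrite /lorentz_modular -ge0_integralZl//; last first.
  by move=> t _; exact: modular_integrand_ge0.
apply: ae_ge0_le_integral; first by [].
- by move=> t _; exact: modular_integrand_ge0.
- exact: measurable_modular_integrand.
- by move=> t _; rewrite mule_ge0//; exact: modular_integrand_ge0.
- by apply: emeasurable_funM => //; exact: measurable_cst.
- apply: filterS fg => t fgt; rewrite /= in_itv/= andbT => /fgt {}fgt.
  by rewrite muleCA; apply: lee_pmul => //;
    rewrite ?lee_fin ?powR_ge0// poweR_ge0.
Qed.

Lemma le_modularZ_ae c (K : R) f g : 0 < c -> 0 <= K ->
  (\forall t \ae lam, 0 < t -> c `^ q t <= K) ->
  (forall x, `|f x| <= c * `|g x|) ->
  (lorentz_modular p q f <= K%:E * lorentz_modular p q g)%E.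
Proof.
move=> c0 K0 cK fg; apply: le_modular_ae => //.
apply: filterS cK => t cK t0.
have qt0 := exponent_gt0 hq t0.
apply: (@le_trans _ _ ((c%:E * rearrangement g t) `^ q t)%E).
  apply: gt0_ler_poweR; [exact: ltW| | |exact: le_rearrangementZ].
  - by rewrite in_itv/= leey rearrangement_ge0.
  - by rewrite in_itv/= leey mule_ge0// ?lee_fin ?rearrangement_ge0// ltW.
rewrite poweRM ?rearrangement_ge0// ?lee_fin ?(ltW c0)// poweR_EFin.
apply: lee_pmul; rewrite ?lee_fin ?cK ?powR_ge0 ?poweR_ge0//.
Qed.

(** The factor c^q(t) depends on t, but it is at most max(1, c)^Q almost everywhere. *)
Lemma le_modularZ c : 0 < c -> exists2 K : R, 0 <= K &
  forall f g, (forall x, `|f x| <= c * `|g x|) ->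
  (lorentz_modular p q f <= K%:E * lorentz_modular p q g)%E.
Proof.
move=> c0; have [Q qQ] := exponent_bounds hq.
exists ((Num.max 1 c) `^ Q) => [|f g fg]; first exact: powR_ge0.
apply: le_modularZ_ae fg => //; first exact: powR_ge0.
apply: filterS qQ => t qQ t0; have /andP[q1 {}qQ] := qQ t0.
apply: (@le_trans _ _ ((Num.max 1 c) `^ q t)).
  apply: ge0_ler_powR.
  - exact/ltW/(exponent_gt0 hq).
  - by rewrite nnegrE ltW.
  - by rewrite nnegrE (le_trans ler01)// le_max lexx.
  - by rewrite le_max lexx orbT.
by apply: ler_powR => //; rewrite le_max lexx.
Qed.

(** For c <= 1 and q >= 1 one has c^q <= c. This linear bound stands in for homogeneity when a
    function is normalized by its modular. *)
Lemma le_modularZ1 c f g : 0 < c <= 1 ->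
  (forall x, `|f x| <= c * `|g x|) ->
  (lorentz_modular p q f <= c%:E * lorentz_modular p q g)%E.
Proof.
move=> /andP[c0 c1] fg; apply: le_modularZ_ae fg => //; first exact: ltW.
have [Q qQ] := exponent_bounds hq.
apply: filterS qQ => t qQ t0; have /andP[q1 _] := qQ t0.
by apply: ge1r_powR => //; rewrite c0.
Qed.

Lemma le_modular f g : (forall x, `|f x| <= `|g x|) ->
  (lorentz_modular p q f <= lorentz_modular p q g)%E.
Proof.
move=> fg; rewrite -[leRHS]mul1e; apply: le_modularZ1; first by rewrite ltr01 lexx.
by move=> x; rewrite mul1r.
Qed.

Lemma modular_ge0 f : (0 <= lorentz_modular p q f)%E.
Proof. by apply: integral_ge0 => t _; exact: modular_integrand_ge0. Qed.

(** Controls the factor t^(q/p - 1) of the modular: the lower bound makes it integrable at 0 and not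
    integrable at infinity, and the upper bound limits its growth. The two follow from q >= 1, p <=
    P and from p >= 1. *)
Lemma exponent_quotient : exists2 c : R, 0 < c &
  \forall t \ae lam, 0 < t -> c <= q t / p t <= q t.
Proof.
have [P pP] := exponent_bounds hp; have [Q qQ] := exponent_bounds hq.
(* The maximum ensures positivity without extracting a point at which 1 <= p(t) <= P. *)
exists (Num.max 1 P)^-1; first by rewrite invr_gt0 lt_max ltr01.
apply: filterS2 pP qQ => t pP qQ t0.
have /andP[p1 {}pP] := pP t0; have /andP[q1 _] := qQ t0.
have p0 : 0 < p t by exact: lt_le_trans p1.
have q0 : 0 < q t by exact: lt_le_trans q1.
apply/andP; split; last by rewrite ler_pdivrMr// ler_peMr// ltW.
rewrite ler_pdivlMr// mulrC; apply: le_trans q1.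
by rewrite ler_pdivrMr ?mul1r ?le_max ?pP ?orbT// lt_max ltr01.
Qed.

Lemma lorentz_finite_measure f s : lorentz p q f -> 0 < s ->
  (mu [set x | (s < `|f x|)%R] < +oo)%E.
Proof.
(* Otherwise [rearrangement f >= s] everywhere, and the modular dominates a
   multiple of the integral of [t ^ (c - 1)] over [1, N] for every [N]. *)
move=> [_ modf] s0; rewrite ltey; apply/eqP => muoo.
have fs t : (s%:E <= rearrangement f t)%E by exact: rearrangement_ge muoo.
have [c c0 cq] := exponent_quotient; have [Q qQ] := exponent_bounds hq.
(* As min(1, s) <= 1 and q <= Q, this constant bounds s^q(t) from below for almost every t. *)
pose K := (Num.min 1 s) `^ Q.
have m0 : 0 < Num.min 1 s by rewrite lt_min ltr01.
have K0 : 0 < K by exact: powR_gt0.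
have modfin : lorentz_modular p q f \is a fin_num.
  by rewrite ge0_fin_numE// modular_ge0.
pose M := fine (lorentz_modular p q f).
have M0 : 0 <= M by rewrite fine_ge0// modular_ge0.
have lowN N : 1 < N -> K * ((N `^ c - 1) / c) <= M.
  move=> N1; rewrite -lee_fin EFinM /M fineK//.
  have := integral_powR ltr01 N1 (lt0r_neq0 c0); rewrite powR1 => <-.
  have mN : measurable (`[1%R, N]%classic : set (lebesgue_line R)).
    by apply: measurable_line; exact: measurable_itv.
  have NS : (`[1%R, N]%classic : set (lebesgue_line R)) `<=` D.
    move=> x /=; rewrite !in_itv/= => /andP[x1 _]; rewrite andbT.
    exact: lt_le_trans x1.
  have mpow : measurable_fun (`[1%R, N]%classic : set (lebesgue_line R))
      (fun t : lebesgue_line R => (t `^ (c - 1))%:E).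
    apply: measurable_fun_line; first exact: measurable_itv.
    by apply/measurable_EFinP; exact: measurable_funTS.
  rewrite -ge0_integralZl//; last 2 first.
  - by move=> t _; rewrite lee_fin powR_ge0.
  - by rewrite lee_fin ltW.
  apply: (@le_trans _ _ (\int[lam]_(t in `[1%R, N]) modular_integrand f t)%E); last first.
    apply: ge0_subset_integral => //; first exact: measurable_pos.
      exact: measurable_modular_integrand.
    by move=> t _; exact: modular_integrand_ge0.
  apply: ae_ge0_le_integral; first by [].
  - by move=> t _; rewrite -EFinM lee_fin mulr_ge0 ?powR_ge0.
  - by apply: emeasurable_funM => //; exact: measurable_cst.
  - by move=> t _; exact: modular_integrand_ge0.
  - exact: measurable_funS (@measurable_pos R) NS (measurable_modular_integrand f).
  apply: filterS2 cq qQ => t cq qQ; rewrite /= in_itv/= => /andP[t1 _].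
  have t0 : 0 < t by exact: lt_le_trans t1.
  have /andP[{}cq _] := cq t0; have /andP[q1 {}qQ] := qQ t0.
  rewrite muleC /modular_integrand; apply: lee_pmul.
  - by rewrite lee_fin powR_ge0.
  - by rewrite lee_fin powR_ge0.
  - by rewrite lee_fin; apply: ler_powR => //; rewrite lerD2r.
  apply: (@le_trans _ _ ((Num.min 1 s) `^ q t)%:E).
    rewrite lee_fin; apply: ger_powR => //.
    by rewrite m0 ge_min lexx.
  rewrite -poweR_EFin; apply: gt0_ler_poweR.
  - by rewrite (le_trans _ q1).
  - by rewrite in_itv/= leey lee_fin ltW.
  - by rewrite in_itv/= leey rearrangement_ge0.
  - by apply: le_trans (fs t); rewrite lee_fin ge_min lexx orbT.
(* Solves K (a - 1) / c = M + 1, so that N = a^(1/c) contradicts [lowN]. *)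
pose a := 1 + c * (M + 1) / K.
have a1 : 1 < a by rewrite ltrDl divr_gt0// mulr_gt0// ltr_wpDl.
have a0 : 0 < a by exact: lt_trans a1.
have := lowN (a `^ c^-1).
rewrite -powRrM mulVf ?gt_eqF// powRr1 ?(ltW a0)//.
have -> : 1 < a `^ c^-1.
  by rewrite /powR gt_eqF// expR_gt1 mulr_gt0 ?invr_gt0 ?ln_gt0.
move=> /(_ isT); rewrite (_ : _ * _ = M + 1); last first.
  by rewrite /a; field; rewrite !gt_eqF.
by rewrite leNgt ltrDl ltr01.
Qed.

(** * Order continuity of the modular *)

Lemma ge0_cvge0 (u : nat -> \bar R) : (forall k, 0 <= u k)%E ->
  (forall e : R, 0 < e -> \forall k \near \oo, (u k <= e%:E)%E) ->
  (u k @[k --> \oo] --> 0)%E.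
Proof.
move=> u0 ue; apply/fine_cvgP; split.
  apply: filterS (ue 1 ltr01) => k uk.
  by rewrite ge0_fin_numE// (le_lt_trans uk)// ltry.
apply/cvgrPdist_le => e e0; apply: filterS (ue e e0) => k uk.
rewrite sub0r normrN ger0_norm ?fine_ge0//.
by rewrite -lee_fin fineK// ge0_fin_numE// (le_lt_trans uk)// ltry.
Qed.

(** The unions over j >= k of the sets {|f_j| > s} decrease to the empty set by pointwise
    convergence, and all lie in {|f| > s}, of finite measure. Continuity from above makes their
    measures drop below t. *)
Lemma rearrangement_near0 f (f_ : nat -> X -> R) s t : lorentz p q f ->
  (forall k, measurable_fun setT (f_ k)) ->
  (forall k x, `|f_ k x| <= `|f x|) ->
  (forall x, f_ k x @[k --> \oo] --> 0) -> 0 < s -> 0 < t ->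
  \forall k \near \oo, (rearrangement (f_ k) t <= s%:E)%E.
Proof.
move=> lf mf ff f0 s0 t0.
pose E k := [set x | s < `|f_ k x|] : set X.
pose F k := \bigcup_(j in [set j | (k <= j)%N]) E j.
have mE k : measurable (E k).
  rewrite /E -[X in measurable X]setTI.
  have mnf : measurable_fun setT (fun x => `|f_ k x|).
    by apply: measurableT_comp => //; exact: mf.
  rewrite (_ : [set x | _] = (fun x => `|f_ k x|) @^-1` `]s, +oo[%classic).
    by apply: mnf => //; exact: measurable_itv.
  by apply/seteqP; split => x; rewrite /= in_itv/= andbT.
have mF k : measurable (F k) by apply: bigcup_measurable.
have F0 : \bigcap_k F k = set0.
  apply/seteqP; split => // x Fx.
  have /cvgr0Pnorm_lt/(_ _ s0)[N _ NP] := f0 x.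
  by have [j /= Nj] := Fx N I; rewrite /E/= ltNge (ltW (NP j Nj)).
have Fcvg : (mu \o F) k @[k --> \oo] --> mu (\bigcap_k F k).
  apply: nonincreasing_cvg_mu => //.
  - apply: le_lt_trans (lorentz_finite_measure lf s0).
    by apply: le_lebesgue_outer => x [j _] /lt_le_trans; exact.
  - by rewrite F0.
  - move=> k j kj; apply/subsetPset => x [i /= ji Ei].
    by exists i => //=; exact: leq_trans ji.
rewrite F0 measure0 in Fcvg.
have : \forall k \near \oo, ((mu \o F) k < t%:E)%E.
  have nb : nbhs (0 : \bar R)%E [set y | (y < t%:E)%E].
    by apply: open_nbhs_nbhs; split; [exact: open_ereal_lt_ereal|rewrite /= lte_fin].
  exact: Fcvg nb.
apply: filterS => k Fk; apply: rearrangement_le; first exact: ltW.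
apply/ltW; apply: le_lt_trans Fk; apply: le_lebesgue_outer => x Ex.
by exists k => /=.
Qed.

Lemma modular_cvg0 f (f_ : nat -> X -> R) : lorentz p q f ->
  (forall k, measurable_fun setT (f_ k)) ->
  (forall k x, `|f_ k x| <= `|f x|) ->
  (forall x, f_ k x @[k --> \oo] --> 0) ->
  (lorentz_modular p q (f_ k) @[k --> \oo] --> 0)%E.
Proof.
move=> lf mf ff f0.
have mD := @measurable_pos R.
have dom k t : 0 < t -> (modular_integrand (f_ k) t <= modular_integrand f t)%E.
  move=> t0; apply: lee_pmul; rewrite ?lee_fin ?powR_ge0 ?poweR_ge0//.
  apply: gt0_ler_poweR; [exact/ltW/(exponent_gt0 hq)| | |].
  - by rewrite in_itv/= leey rearrangement_ge0.
  - by rewrite in_itv/= leey rearrangement_ge0.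
  - exact: le_rearrangement.
have [] := @dominated_convergence _ (lebesgue_line R) R lam D mD
  (fun k => modular_integrand (f_ k)) (cst 0%E) (modular_integrand f).
- by move=> k; exact: measurable_modular_integrand.
- exact: measurable_cst.
- apply: aeW => t; rewrite /= in_itv/= andbT => t0.
  have qt0 := exponent_gt0 hq t0.
  apply: ge0_cvge0 => [k|e e0]; first exact: modular_integrand_ge0.
  set a := t `^ (q t / p t - 1).
  have a0 : 0 <= a by exact: powR_ge0.
  (* Chosen so that a s^q(t) = a e / (a + 1) <= e; the 1 keeps the denominator positive. *)
  pose s := (e / (a + 1)) `^ (q t)^-1.
  have ea0 : 0 < e / (a + 1) by rewrite divr_gt0// ltr_wpDl.
  have s0 : 0 < s by exact: powR_gt0.
  apply: filterS (rearrangement_near0 lf mf ff f0 s0 t0) => k fks.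
  apply: (@le_trans _ _ (a%:E * (s%:E `^ q t))%E).
    apply: lee_pmul => //; rewrite ?lee_fin// ?poweR_ge0//.
    apply: gt0_ler_poweR; [exact/ltW| | |by []].
    + by rewrite in_itv/= leey rearrangement_ge0.
    + by rewrite in_itv/= leey lee_fin ltW.
  rewrite poweR_EFin -EFinM lee_fin /s -powRrM mulVf ?gt_eqF// powRr1 ?(ltW ea0)//.
  rewrite mulrA ler_pdivrMr ?ltr_wpDl// mulrC ler_pM2l//.
  by rewrite lerDl.
- apply/integrableP; split; first exact: measurable_modular_integrand.
  under eq_integral do rewrite gee0_abs ?modular_integrand_ge0//.
  by case: lf.
- apply: aeW => t k; rewrite /= in_itv/= andbT => t0.
  by rewrite gee0_abs ?modular_integrand_ge0//; exact: dom.
by move=> _ _; rewrite integral0.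
Qed.

End modular.

(** * A positive function in the Lorentz space *)

Section weight.
Context {R : realType} {n : nat}.
Local Notation X := (euclid R n).
Local Notation mu := (@lebesgue_euclid R n).
Local Notation lam := (@completed_lebesgue_measure R).

Let cube_ex (x : X) : exists k, `[< cube k x >].
Proof. by have [k kx] := cube_exhaust x; exists k; exact/asboolP. Qed.

Definition cube_index (x : X) : nat := ex_minn (cube_ex x).

Lemma cube_indexP (x : X) k : (cube_index x <= k)%N <-> cube k x.
Proof.
rewrite /cube_index; case: ex_minnP => j /asboolP jx jmin; split => [jk|kx].
  exact: subset_cube jk x jx.
by apply: jmin; exact/asboolP.
Qed.

Lemma measurable_cube_index j : measurable [set x : X | cube_index x = j].
Proof.
case: j => [|j].
  rewrite (_ : [set x | _] = cube 0); first exact: measurable_cube.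
  apply/seteqP; split => x /= => [x0|/cube_indexP]; first by apply/cube_indexP; rewrite x0.
  by rewrite leqn0 => /eqP.
rewrite (_ : [set x | _] = cube j.+1 `\` cube j).
  by apply: measurableD; exact: measurable_cube.
apply/seteqP; split => x /= => [xj|[/cube_indexP xj1 xj]].
  by split; [apply/cube_indexP; rewrite xj|move/cube_indexP; rewrite xj ltnn].
apply/eqP; rewrite eqn_leq xj1/= ltnNge; apply/negP => /cube_indexP.
exact: xj.
Qed.

(* [cube_size k] dominates both [k] and the measure of [cube k]; hence the set
   where [weight > (1 + t)^-2] lies in a single cube, of measure at most [t]. *)
Definition cube_size k : R := fine (mu (cube k)) + k%:R.

Definition weight (x : X) : R := ((1 + cube_size (cube_index x)) ^+ 2)^-1.

Lemma cube_size_ge0 k : 0 <= cube_size k.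
Proof. by rewrite addr_ge0// fine_ge0. Qed.

Lemma weight_gt0 x : 0 < weight x.
Proof. by rewrite invr_gt0 exprn_gt0// ltr_wpDr// cube_size_ge0. Qed.

Lemma measurable_weight : measurable_fun setT weight.
Proof.
move=> _ Y _; rewrite setTI.
rewrite (_ : _ @^-1` _ = \bigcup_(j in [set j | Y ((1 + cube_size j) ^+ 2)^-1])
    [set x : X | cube_index x = j]).
  by apply: bigcup_measurable => j _; exact: measurable_cube_index.
by apply/seteqP; split => [x Yx|x [j Yj /= xj]]; [exists (cube_index x)|rewrite /weight/= xj].
Qed.

Lemma rearrangement_weight (t : R) : 0 < t ->
  (rearrangement weight t <= (((1 + t) ^+ 2)^-1)%:E)%E.
Proof.
move=> t0; apply: rearrangement_le; first by rewrite invr_ge0 sqr_ge0.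
have sub x : ((1 + t) ^+ 2)^-1 < `|weight x| -> cube_size (cube_index x) < t.
  rewrite ger0_norm ?ltW ?weight_gt0// /weight.
  have := cube_size_ge0 (cube_index x); set s := cube_size _ => s0.
  rewrite ltf_pV2 ?posrE ?exprn_gt0//; [|lra|lra].
  by rewrite ltr_pXn2r// ?nnegrE; lra.
(* Either the level set is empty, or the indices of size below t are bounded, since [cube_size k] is
   at least k, and the cube of largest such index contains the level set. *)
have [[k kt]|nk] := pselect (exists k, cube_size k < t); last first.
  rewrite (_ : [set x | _] = set0) ?measure0 ?lee_fin ?ltW//.
  by apply/seteqP; split => // x /sub xt; apply: nk; exists (cube_index x).
have bd j : cube_size j < t -> (j <= Num.bound t)%N.
  move=> jt; rewrite -(ler_nat R); apply: ltW.
  apply: (lt_trans _ (archi_boundP (ltW t0))); apply: le_lt_trans jt.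
  by rewrite /cube_size lerDr fine_ge0.
have [K Kt Kmax] := ex_maxnP (ex_intro (fun k => cube_size k < t) k kt) bd.
apply: (@le_trans _ _ (mu (cube K))).
  by apply: le_lebesgue_outer => x /sub xt; apply/cube_indexP; exact: Kmax.
rewrite -(@fineK _ (mu (cube K))) ?ge0_fin_numE ?cube_lty//.
by rewrite lee_fin; apply: le_trans (ltW Kt); rewrite /cube_size lerDl.
Qed.

(** On (0, 1] the rearrangement is at most 1 and the integrand at most t^(c - 1). Beyond 1 it is at
    most t to the power q/p - 1 - 2q <= -q - 1 <= -2. Decay of order 1 instead of 2 would only give
    the borderline bound t^-1. *)
Lemma lorentz_weight (p q : R -> R) : exponentP1 p -> exponentP1 q ->
  lorentz p q weight.
Proof.
move=> hp hq; split; first exact: measurable_weight.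
have [c c0 cq] := exponent_quotient hp hq; have [Q qQ] := exponent_bounds hq.
have DE : `]0%R, +oo[%classic = `]0%R, 1%R] `|` `]1%R, +oo[ :> set R.
  apply/seteqP; split => x /=; rewrite !in_itv/= !andbT.
    by case: (leP x 1) => x1 x0; [left; rewrite x0|right].
  by move=> [/andP[]//|x1]; exact: lt_trans x1.
have m1 : measurable (`]0%R, 1%R]%classic : set (lebesgue_line R)).
  by apply: measurable_line; exact: measurable_itv.
have m2 : measurable (`]1%R, +oo[%classic : set (lebesgue_line R)).
  by apply: measurable_line; exact: measurable_itv.
have mw := measurable_modular_integrand hp hq weight.
have mpow r : measurable_fun setT (fun t : lebesgue_line R => (t `^ r)%:E).
  apply: measurable_fun_line => //.
  by apply/measurable_EFinP; exact: measurable_powR.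
rewrite /lorentz_modular DE (@ge0_integral_setU _ (lebesgue_line R) R lam _ _ m1 m2); first last.
- apply/disj_setPS => x [] /=; rewrite !in_itv/= andbT => /andP[_ x1] x1'.
  by move: (lt_le_trans x1' x1); rewrite ltxx.
- by move=> t _; exact: modular_integrand_ge0.
- by rewrite -DE; exact: mw.
apply: lte_add_pinfty.
- apply: le_lt_trans (ltry c^-1); apply: le_trans (integral_powR_near0 c0).
  apply: ae_ge0_le_integral.
  + by [].
  + by move=> t _; exact: modular_integrand_ge0.
  + by apply: measurable_funS mw; [exact: measurable_pos|rewrite DE; exact: subsetUl].
  + by move=> t _; rewrite lee_fin powR_ge0.
  + exact: measurable_funTS.
  apply: filterS cq => t cq; rewrite /= in_itv/= => /andP[t0 t1].
  have /andP[{}cq _] := cq t0.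
  rewrite -[leRHS]mule1; apply: lee_pmul.
  + by rewrite lee_fin powR_ge0.
  + exact: poweR_ge0.
  + by rewrite lee_fin; apply: ger_powR; rewrite ?t0// lerD2r.
  rewrite -[leRHS](poweR1r (q t)); apply: gt0_ler_poweR.
  + exact/ltW/(exponent_gt0 hq).
  + by rewrite in_itv/= leey rearrangement_ge0.
  + by rewrite in_itv/= leey lee01.
  apply: le_trans (rearrangement_weight t0) _; rewrite lee_fin.
  by rewrite invf_le1 ?exprn_gt0 ?exprn_ege1//; lra.
- apply: le_lt_trans (ltry 1^-1).
  apply: le_trans (integral_powR_nearoo (@ltr01 R)).
  apply: (@le_trans _ _ (\int[lam]_(t in `]1%R, +oo[) (t `^ (- 1 - 1))%:E)%E); last first.
    apply: ge0_subset_integral.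
    + by [].
    + by apply: measurable_line; exact: measurable_itv.
    + exact: measurable_funTS.
    + by move=> t _; rewrite lee_fin powR_ge0.
    + by move=> t /=; rewrite !in_itv/= !andbT; exact: ltW.
  apply: ae_ge0_le_integral.
  + by [].
  + by move=> t _; exact: modular_integrand_ge0.
  + by apply: measurable_funS mw; [exact: measurable_pos|rewrite DE; exact: subsetUr].
  + by move=> t _; rewrite lee_fin powR_ge0.
  + exact: measurable_funTS.
  apply: filterS2 cq qQ => t cq qQ; rewrite /= in_itv/= andbT => t1.
  have t0 : 0 < t by exact: lt_trans t1.
  have /andP[_ {}cq] := cq t0; have /andP[q1 _] := qQ t0.
  apply: (@le_trans _ _ ((t `^ (q t / p t - 1))%:E * (t `^ (- 2))%:E `^ q t)%E).
    apply: lee_pmul => //.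
    + by rewrite lee_fin powR_ge0.
    + exact: poweR_ge0.
    apply: gt0_ler_poweR.
    + exact/ltW/(exponent_gt0 hq).
    + by rewrite in_itv/= leey rearrangement_ge0.
    + by rewrite in_itv/= leey lee_fin powR_ge0.
    apply: le_trans (rearrangement_weight t0) _; rewrite lee_fin.
    rewrite powR_invn ?(ltW t0)// lef_pV2 ?posrE ?exprn_gt0//; last by lra.
    by rewrite ler_pXn2r ?nnegrE//; lra.
  rewrite poweR_EFin -EFinM lee_fin -powRrM -powRD; last by apply/implyP => _; rewrite gt_eqF.
  by apply: ler_powR; [exact: ltW|lra].
Qed.

End weight.

(** * Lattice property and the Luxemburg norm *)

Section norm.
Context {R : realType} {n : nat} (p q : R -> R).
Hypotheses (hp : exponentP1 p) (hq : exponentP1 q).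
Local Notation X := (euclid R n).
Implicit Types (f g : X -> R) (c l : R).
Local Opaque lorentz_modular.

(** Most memberships below come from domination by a function already in the space, instead of a
    modular computation. *)
Lemma lorentz_ideal c f g : 0 < c -> lorentz p q f -> measurable_fun setT g ->
  (forall x, `|g x| <= c * `|f x|) -> lorentz p q g.
Proof.
move=> c0 [mf modf] mg gf; split; first exact: mg.
have [K K0 /(_ g f gf) gK] := @le_modularZ R n p q hp hq c c0.
by apply: (le_lt_trans gK); rewrite lte_mul_pinfty// lee_fin.
Qed.

Lemma lorentz_norm_le1 f : measurable_fun setT f ->
  (lorentz_modular p q f <= 1)%E ->
  lorentz p q f /\ (lorentz_norm p q f <= 1)%E.
Proof.
move=> mf f1; split; first by split => //; rewrite (le_lt_trans f1)// ltry.
apply: ereal_inf_lbound; exists 1; last by [].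
split; first exact: ltr01.
rewrite (_ : (fun x => f x / 1) = f); first exact: f1.
by apply/funext => x; rewrite divr1.
Qed.

Lemma lorentz_norm_lt f c : (lorentz_norm p q f < c%:E)%E ->
  exists l, [/\ 0 < l, l < c & (lorentz_modular p q (fun x => f x / l)%R <= 1)%E].
Proof. by move=> /ereal_inf_lt[_ [l [l0 fl] <-]]; rewrite lte_fin => lc; exists l. Qed.

Lemma lorentz_norm_ltP f c l : 0 < l -> l < c ->
  (lorentz_modular p q (fun x => f x / l)%R <= 1)%E ->
  (lorentz_norm p q f < c%:E)%E.
Proof.
move=> l0 lc fl; apply: (@le_lt_trans _ _ l%:E); last by rewrite lte_fin.
by apply: ereal_inf_lbound; exists l; first by split; [exact: l0|exact: fl].
Qed.

(** With l the maximum of 1 and the modular of f, [le_modularZ1] bounds the modular of f / l by that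
    of f divided by l. *)
Lemma lorentz_absorb f : lorentz p q f ->
  exists2 l, 0 < l & (lorentz_modular p q (fun x => f x / l)%R <= 1)%E.
Proof.
move=> [mf modf].
have modfin : lorentz_modular p q f \is a fin_num.
  by rewrite ge0_fin_numE// modular_ge0.
pose l := Num.max 1 (fine (lorentz_modular p q f)).
have l1 : 1 <= l by rewrite le_max lexx.
have l0 : 0 < l by exact: lt_le_trans l1.
exists l => //; apply: (@le_trans _ _ (l^-1%:E * lorentz_modular p q f)%E).
  apply: le_modularZ1 => //; first by rewrite invr_gt0 l0 invf_le1.
  by move=> x; rewrite normrM mulrC ger0_norm ?invr_ge0// ltW.
rewrite -(fineK modfin) -EFinM lee_fin mulrC ler_pdivrMr// mul1r.
by rewrite le_max lexx orbT.
Qed.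

(** Convergence of modulars, applied to the functions f_k / (d / 2), brings them below 1, so that
    the norm of f_k is at most d / 2. *)
Lemma lorentz_norm_cvg0 f (f_ : nat -> X -> R) d : lorentz p q f ->
  (forall k, measurable_fun setT (f_ k)) ->
  (forall k x, `|f_ k x| <= `|f x|) ->
  (forall x, f_ k x @[k --> \oo] --> 0) -> 0 < d ->
  \forall k \near \oo, (lorentz_norm p q (f_ k) < d%:E)%E.
Proof.
move=> lf mf ff f0 d0; have l0 : 0 < d / 2 by rewrite divr_gt0.
have mdiv g : measurable_fun setT g -> measurable_fun setT (fun x => g x / (d / 2)).
  by move=> mg; apply: measurable_funM => //; exact: measurable_cst.
have cvg0 : (lorentz_modular p q (fun x => f_ k x / (d / 2))%R @[k --> \oo] --> 0)%E.
  apply: (@modular_cvg0 _ _ _ _ hp hq (fun x => f x / (d / 2))).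
  - apply: (@lorentz_ideal (d / 2)^-1 f).
    + by rewrite invr_gt0.
    + exact: lf.
    + by apply: mdiv; case: lf.
    + by move=> x; rewrite normrM mulrC [`|_^-1|]ger0_norm// invr_ge0 ltW.
  - by move=> k; exact: mdiv.
  - by move=> k x; rewrite !normrM ler_wpM2r.
  - by move=> x; rewrite -(mul0r (d / 2)^-1); apply: cvgMl; exact: f0.
have nb : nbhs (0 : \bar R)%E [set y | (y < 1%:E)%E].
  by apply: open_nbhs_nbhs; split; [exact: open_ereal_lt_ereal|rewrite /= lte_fin].
have : \forall k \near \oo,
    (lorentz_modular p q (fun x => f_ k x / (d / 2))%R < 1)%E by exact: cvg0 nb.
apply: filterS => k fk.
by apply: (@lorentz_norm_ltP _ _ (d / 2) l0); [lra|exact: ltW].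
Qed.

End norm.

(** * The pairing with the Koethe dual *)

Section pairing.
Context {R : realType} {n : nat} (p q : R -> R).
Hypotheses (hp : exponentP1 p) (hq : exponentP1 q).
Local Notation X := (euclid R n).
Local Notation mu := (@lebesgue_euclid R n).
Implicit Types (f g h : X -> R) (A : set X).
Local Opaque lorentz_modular lorentz_norm lorentz.

(** A sign that never vanishes, so that multiplication by it preserves |f| everywhere and hence the
    norm. As a difference of indicators it splits by linearity. *)
Definition signed_indic A (x : X) : R := \1_A x - \1_(~` A) x.

Lemma signed_indicE A x : signed_indic A x = if x \in A then 1 else -1.
Proof. by rewrite /signed_indic !indicE in_setC; case: (x \in A); rewrite ?subr0 ?sub0r. Qed.

Lemma norm_signed_indic A x : `|signed_indic A x| = 1.
Proof. by rewrite signed_indicE; case: ifP; rewrite ?normrN normr1. Qed.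

Lemma measurable_signed_indic A : measurable A ->
  measurable_fun setT (signed_indic A).
Proof.
move=> mA; apply: measurable_funB; apply: measurable_indic => //.
exact: measurableC.
Qed.

Lemma measurable_nonneg f : measurable_fun setT f ->
  measurable [set x | 0 <= f x].
Proof.
move=> mf; rewrite (_ : [set x | _] = setT `&` f @^-1` `[0, +oo[%classic).
  by apply: mf; [exact: measurableT|exact: measurable_itv].
by rewrite setTI; apply/seteqP; split => x; rewrite /= in_itv/= andbT.
Qed.

Lemma mul_signed_indic f x : f x * signed_indic [set x | 0 <= f x] x = `|f x|.
Proof.
rewrite signed_indicE; case: ifPn; rewrite ?inE ?notin_setE /= => fx.
  by rewrite mulr1 ger0_norm.
by rewrite mulrN1 ltr0_norm// ltNge; apply/negP.
Qed.

Lemma lorentz_measurable f : lorentz p q f -> measurable_fun setT f.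
Proof. by case. Qed.

Lemma le_lorentz_norm f g : (forall x, `|f x| <= `|g x|) ->
  (lorentz_norm p q f <= lorentz_norm p q g)%E.
Proof.
move=> fg; apply: ereal_inf_le_tmp => _ [l [l0 gl] <-].
exists l; last by [].
split; first exact: l0.
apply: le_trans gl; apply: le_modular.
- exact: hp.
- exact: hq.
- by move=> x; rewrite !normrM ler_wpM2r.
Qed.

Lemma lorentz_norm_eq f g : (forall x, `|f x| = `|g x|) ->
  lorentz_norm p q f = lorentz_norm p q g.
Proof.
by move=> fg; apply/eqP; rewrite eq_le; apply/andP; split;
  apply: le_lorentz_norm => x; rewrite fg.
Qed.

(** Turns the integral of |f h|, which defines the Koethe norm, into the integral of a product f' h
    with f' of the same norm: f' is f times the sign of f h. *)
Lemma lorentz_twist f h : lorentz p q f -> measurable_fun setT h ->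
  exists f', [/\ lorentz p q f', lorentz_norm p q f' = lorentz_norm p q f,
    (forall x, f' x * h x = `|f x * h x|) & (forall x, `|f' x| = `|f x|)].
Proof.
move=> lf mh; have mf := lorentz_measurable lf.
pose A := [set x | 0 <= f x * h x].
have mA : measurable A by apply: measurable_nonneg; exact: measurable_funM.
have nf x : `|f x * signed_indic A x| = `|f x|.
  by rewrite normrM norm_signed_indic mulr1.
exists (fun x => f x * signed_indic A x); split.
- apply: (@lorentz_ideal _ _ _ _ hp hq 1 f).
  + exact: ltr01.
  + exact: lf.
  + by apply: measurable_funM; [exact: mf|exact: measurable_signed_indic].
  + by move=> x; rewrite nf mul1r.
- exact: lorentz_norm_eq.
- by move=> x; rewrite mulrAC (mul_signed_indic (fun x => f x * h x)).
- exact: nf.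
Qed.

Definition pairing g f : R := \int[mu]_x (f x * g x).

Lemma koethe_norm_ub g f : lorentz p q f -> (lorentz_norm p q f <= 1)%E ->
  (\int[mu]_x `|f x * g x|%:E <= koethe_norm p q g)%E.
Proof.
move=> lf f1; apply: ereal_sup_ubound; exists f; first by split; [exact: lf|exact: f1].
rewrite Lnorm1; apply: eq_integral => x _ /=.
by rewrite mulrC.
Qed.

Lemma koethe_measurable g : koethe_dual p q g -> measurable_fun setT g.
Proof. by case. Qed.

Lemma koethe_norm_fin g : koethe_dual p q g ->
  koethe_norm p q g = (fine (koethe_norm p q g))%:E /\
  0 <= fine (koethe_norm p q g).
Proof.
move=> [mg glty].
(* A supremum over an empty unit ball would be -oo; the rescaled weight is an element of the
   ball. *)
have k0 : (0 <= koethe_norm p q g)%E.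
  have mw := measurable_weight (R := R) (n := n).
  have [l l0 wl] := lorentz_absorb hp hq (lorentz_weight (n := n) hp hq).
  have [lf f1] := lorentz_norm_le1
    (measurable_funM mw (@measurable_cst _ _ _ _ setT l^-1)) wl.
  apply: le_trans (koethe_norm_ub g lf f1).
  by apply: integral_ge0 => x _; rewrite lee_fin.
by rewrite fine_ge0// fineK// ge0_fin_numE.
Qed.

(** Hölder's inequality with l in place of the norm of f, which may be 0 for a nonzero f: the
    function f / l is in the unit ball. *)
Lemma pairing_modular g f l : koethe_dual p q g -> measurable_fun setT f ->
  0 < l -> (lorentz_modular p q (fun x => f x / l)%R <= 1)%E ->
  (\int[mu]_x `|f x * g x|%:E <= (l * fine (koethe_norm p q g))%:E)%E.
Proof.
move=> Kg mf l0 fl; have mg := koethe_measurable Kg.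
have [kE _] := koethe_norm_fin Kg.
have mfl : measurable_fun setT (fun x => f x / l).
  by apply: measurable_funM => //; exact: measurable_cst.
have [lf f1] := lorentz_norm_le1 mfl fl.
have := koethe_norm_ub g lf f1; rewrite kE => fg.
rewrite EFinM -lee_pdivrMl//; apply: le_trans fg.
have lV : `|l^-1| = l^-1 by rewrite ger0_norm// invr_ge0 ltW.
have mfg : measurable_fun setT (fun x => `|f x * g x|%:E).
  apply/measurable_EFinP; apply: measurableT_comp; first exact: normr_measurable.
  exact: measurable_funM.
rewrite -(ge0_integralZl mu measurableT mfg); last 2 first.
- by move=> x _; rewrite lee_fin.
- by rewrite lee_fin invr_ge0 ltW.
rewrite le_eqVlt; apply/orP; left; apply/eqP; apply: eq_integral => x _.
by rewrite -EFinM !normrM lV mulrA (mulrC l^-1).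
Qed.

Lemma pairing_integrable g f : koethe_dual p q g -> lorentz p q f ->
  mu.-integrable setT (EFin \o (fun x => f x * g x)).
Proof.
move=> Kg lf; have [l l0 fl] := lorentz_absorb hp hq lf.
have mf := lorentz_measurable lf; have mg := koethe_measurable Kg.
apply/integrableP; split; first by apply/measurable_EFinP; exact: measurable_funM.
by apply: le_lt_trans (pairing_modular Kg mf l0 fl) _; rewrite ltry.
Qed.

Lemma norm_pairing_le g f (M : R) :
  mu.-integrable setT (EFin \o (fun x => f x * g x)) ->
  (\int[mu]_x `|f x * g x|%:E <= M%:E)%E -> `|pairing g f| <= M.
Proof.
move=> ifg fgM; rewrite -lee_fin EFin_normr_Rintegral//.
apply: le_trans fgM; apply: le_abse_integral; first exact: measurableT.
by case/integrableP : ifg.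
Qed.

Lemma pairing_linear g : koethe_dual p q g ->
  linear_on (lorentz p q) (pairing g).
Proof.
move=> Kg a f1 f2 lf1 lf2; rewrite /pairing.
have i1 := pairing_integrable Kg lf1; have i2 := pairing_integrable Kg lf2.
rewrite -RintegralZl// -RintegralD//; last first.
  apply: eq_integrable (integrableZl measurableT a i1) => // x _.
by apply: eq_Rintegral => x _; rewrite mulrDl mulrA.
Qed.

Lemma pairing_linear_l (a : R) g h : koethe_dual p q g -> koethe_dual p q h ->
  forall f, lorentz p q f ->
  pairing (fun x => a * g x + h x) f = a * pairing g f + pairing h f.
Proof.
move=> Kg Kh f lf; rewrite /pairing.
have i1 := pairing_integrable Kg lf; have i2 := pairing_integrable Kh lf.
rewrite -RintegralZl// -RintegralD//; last first.
  apply: eq_integrable (integrableZl measurableT a i1) => // x _.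
by apply: eq_Rintegral => x _; rewrite mulrDr mulrCA.
Qed.

Lemma pairing_continuous g : koethe_dual p q g ->
  lorentz_continuous p q (pairing g).
Proof.
move=> Kg f lf e e0; have [_ k0] := koethe_norm_fin Kg.
set k := fine _ in k0.
(* The 1 covers the case of a vanishing Koethe norm k. *)
exists (e / (k + 1)); first by rewrite divr_gt0// ltr_wpDl.
move=> h lh /lorentz_norm_lt[l [l0 le hfl]].
have iff := pairing_integrable Kg lf; have ih := pairing_integrable Kg lh.
have mf := lorentz_measurable lf; have mh := lorentz_measurable lh.
have mhf : measurable_fun setT (fun x => h x - f x) by exact: measurable_funB.
have Pb := pairing_modular Kg mhf l0 hfl.
have Pint : mu.-integrable setT (EFin \o (fun x => (h x - f x) * g x)).
  apply/integrableP; split.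
    apply/measurable_EFinP; apply: measurable_funM => //.
    exact: koethe_measurable Kg.
  by apply: le_lt_trans Pb _; rewrite ltry.
have -> : pairing g h - pairing g f = pairing g (fun x => h x - f x).
  rewrite /pairing -RintegralB//; apply: eq_Rintegral => x _.
  by rewrite mulrBl.
apply: le_lt_trans (norm_pairing_le Pint Pb) _.
rewrite -/k (@le_lt_trans _ _ (l * (k + 1)))//.
  by rewrite ler_pM2l// lerDl.
by rewrite -ltr_pdivlMr// ltr_wpDl.
Qed.

Lemma pairing_inj g h : koethe_dual p q g -> koethe_dual p q h ->
  (forall f, lorentz p q f -> pairing g f = pairing h f) <-> g = h %[ae mu].
Proof.
move=> Kg Kh; have mg := koethe_measurable Kg; have mh := koethe_measurable Kh.
split => [gh|gh f lf].
- have mgh : measurable_fun setT (fun x => g x - h x) by exact: measurable_funB.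
  (* A single test function suffices: the weight times the sign of g - h turns equal pairings into a
     vanishing integral of |w (g - h)|. *)
  have [w [lw _ wE wn]] := lorentz_twist (lorentz_weight (n := n) hp hq) mgh.
  have ig := pairing_integrable Kg lw; have ih := pairing_integrable Kh lw.
  have mw := lorentz_measurable lw.
  have int0 : (\int[mu]_x `|(w x * (g x - h x))%:E| = 0)%E.
    have -> : (\int[mu]_x `|(w x * (g x - h x))%:E| =
        \int[mu]_x ((w x * g x)%:E - (w x * h x)%:E))%E.
      apply: eq_integral => x _; rewrite /= -EFinB -mulrBr.
      by rewrite (ger0_norm _) // wE.
    rewrite integralB_EFin//.
    have := gh w lw; rewrite /pairing /Rintegral => /eqP.
    rewrite -eqe !fineK; try exact: integrable_fin_num.
    by move=> /eqP ->; rewrite subee//; exact: integrable_fin_num.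
  have mwgh : measurable_fun setT (fun x => (w x * (g x - h x))%:E).
    by apply/measurable_EFinP; exact: measurable_funM.
  have := (ae_eq_integral_abs mu measurableT mwgh).1 int0.
  apply: filterS => x /(_ I) /= [] wgh _.
  have w0 : w x != 0.
    by rewrite -normr_eq0 wn normr_eq0 gt_eqF// weight_gt0.
  by move/eqP : wgh; rewrite mulf_eq0 (negbTE w0)/= subr_eq0 => /eqP.
- have mf := lorentz_measurable lf.
  rewrite /pairing /Rintegral; congr fine; apply: ae_eq_integral.
  + exact: measurableT.
  + by apply/measurable_EFinP; exact: measurable_funM.
  + by apply/measurable_EFinP; exact: measurable_funM.
  by apply: filterS gh => x ghx _; rewrite ghx.
Qed.

Lemma pairing_dual_norm_le g : koethe_dual p q g ->
  (dual_norm p q (pairing g) <= koethe_norm p q g)%E.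
Proof.
move=> Kg; apply: ge_ereal_sup => _ [f [lf f1] <-].
have [kE _] := koethe_norm_fin Kg.
have := koethe_norm_ub g lf f1; rewrite kE => fg.
by rewrite lee_fin; apply: norm_pairing_le fg; exact: pairing_integrable.
Qed.

Lemma koethe_norm_le_dual g : koethe_dual p q g ->
  (koethe_norm p q g <= dual_norm p q (pairing g))%E.
Proof.
move=> Kg; apply: ge_ereal_sup => _ [f [lf f1] <-].
have [f' [lf' f'1 f'E _]] := lorentz_twist lf (koethe_measurable Kg).
rewrite Lnorm1; apply: (@le_trans _ _ `|pairing g f'|%:E).
  have if' := pairing_integrable Kg lf'.
  rewrite (EFin_normr_Rintegral measurableT if').
  rewrite (_ : (\int[mu]_x _)%E = (\int[mu]_x (f' x * g x)%:E)%E).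
    exact: lee_abs.
  by apply: eq_integral => x _; rewrite f'E /= mulrC.
apply: ereal_sup_ubound; exists f'; last by [].
by split; [exact: lf'|rewrite f'1; exact: f1].
Qed.

End pairing.

(** * Representation of continuous functionals *)

Import HBNNSimple.

Section representation.
Context {R : realType} {n : nat} (p q : R -> R).
Hypotheses (hp : exponentP1 p) (hq : exponentP1 q).
Local Notation X := (euclid R n).
Local Notation mu := (@lebesgue_euclid R n).
Variable L : (X -> R) -> R.
Hypotheses (linL : linear_on (lorentz p q) L) (ctsL : lorentz_continuous p q L).
Implicit Types (f g h : X -> R) (A E : set X).
Local Notation w := (@weight R n).
Local Notation V := (@lorentz R n p q).

Let lw : V w. Proof. exact: lorentz_weight. Qed.

Let V0 : V (fun=> 0).
Proof.
apply: (lorentz_ideal hp hq ltr01 lw); first exact: measurable_cst.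
by move=> x; rewrite normr0 mul1r.
Qed.

Lemma lorentz_weightM (phi : X -> R) (M : R) : measurable_fun setT phi ->
  (forall x, `|phi x| <= M) -> V (fun x => w x * phi x).
Proof.
move=> mphi phiM.
have M1 : 0 < Num.max 1 M by rewrite lt_max ltr01.
apply: (lorentz_ideal hp hq M1 lw).
  by apply: measurable_funM; [exact: measurable_weight|exact: mphi].
move=> x; rewrite normrM mulrC; apply: ler_wpM2r => //.
by rewrite (le_trans (phiM x))// le_max lexx orbT.
Qed.

(** * Boundedness and order continuity of the functional *)

Lemma functional0 : L (fun=> 0) = 0.
Proof.
have := linL 1 V0 V0.
rewrite (_ : (fun x => 1 * 0 + 0) = (fun=> 0 : R)); last first.
  by apply/funext => x; rewrite mulr0 addr0.
by lra.
Qed.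

Lemma functionalZ (a : R) f : V f -> L (fun x => a * f x) = a * L f.
Proof.
move=> lf.
rewrite -[RHS]addr0 -functional0 -(linL a lf V0); congr L.
by apply/funext => x; rewrite addr0.
Qed.

Lemma functional_bounded : exists2 M : R, 0 < M &
  forall f, V f -> (lorentz_norm p q f <= 1)%E -> `|L f| <= M.
Proof.
have [d d0 dL] := ctsL V0 ltr01.
(* Norm at most 1 yields some l < 2 with modular of f / l at most 1. Then d / 4 * f has norm below
   d, so [L] is less than 1 in absolute value there. *)
exists (4 / d) => [|f lf f1]; first by rewrite divr_gt0.
have f2 : (lorentz_norm p q f < 2%:E)%E.
  by apply: le_lt_trans f1 _; rewrite lte_fin ltr1n.
have [l [l0 l2 fl]] := lorentz_norm_lt f2.
have d4 : 0 < d / 4 by rewrite divr_gt0.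
have Vg : V (fun x => d / 4 * f x).
  apply: (lorentz_ideal hp hq d4 lf).
    by apply: measurable_funM; [exact: measurable_cst|exact: lorentz_measurable lf].
  by move=> x; rewrite normrM (ger0_norm (ltW d4)).
have := dL _ Vg; rewrite functional0 subr0 functionalZ// => gd.
have : `|d / 4 * L f| < 1.
  apply: gd; apply: (@lorentz_norm_ltP _ _ _ _ _ _ (l * (d / 4))).
  - by rewrite mulr_gt0.
  - nra.
  rewrite (_ : (fun x => _) = (fun x => f x / l)); first exact: fl.
  by apply/funext => x; field; rewrite !gt_eqF.
rewrite normrM (ger0_norm (ltW d4)) => /ltW dL1.
rewrite ler_pdivlMr// mulrC.
by move: dL1; set z := `|L f|; lra.
Qed.

(** A dominated convergence theorem for [L]: continuity combined with order continuity of the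
    norm. *)
Lemma functional_cvg f h (f_ : nat -> X -> R) : V f -> V h ->
  (forall k, V (f_ k)) -> (forall k x, `|f_ k x - f x| <= `|h x|) ->
  (forall x, f_ k x @[k --> \oo] --> f x) -> L (f_ k) @[k --> \oo] --> L f.
Proof.
move=> lf lh lf_ fh cvgf; apply/cvgrPdist_lt => e e0.
have [d d0 dL] := ctsL lf e0.
have mf := lorentz_measurable lf.
have : \forall k \near \oo, (lorentz_norm p q (fun x => f_ k x - f x)%R < d%:E)%E.
  apply: (lorentz_norm_cvg0 hp hq lh).
  - by move=> k; apply: measurable_funB; [exact: lorentz_measurable (lf_ k)|exact: mf].
  - exact: fh.
  - by move=> x; rewrite -(subrr (f x)); apply: cvgB; [exact: cvgf|exact: cvg_cst].
  - exact: d0.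
apply: filterS => k fk; rewrite distrC; apply: dL; first exact: lf_.
exact: fk.
Qed.

Let bounded_indic E x : `|\1_E x : R| <= 1.
Proof. by rewrite indicE; case: (_ \in _); rewrite ?normr1 ?normr0. Qed.

Lemma lorentz_weight_indic E : measurable E -> V (fun x => w x * \1_E x).
Proof. by move=> mE; apply: (lorentz_weightM _ (bounded_indic E)); exact: measurable_indic. Qed.

(* The positive weight makes this set function finite on all of R^n, although
   the indicator of a set of infinite measure is not in the Lorentz space. *)
Definition functional_charge E : \bar R := (L (fun x => w x * \1_E x))%:E.
Local Notation nu := functional_charge.

Lemma functional_charge0 : nu set0 = 0%E.
Proof.
rewrite /nu (_ : (fun x => _) = (fun=> 0)) ?functional0//.
by apply/funext => x; rewrite indic0 mulr0.
Qed.

Lemma functional_charge_fin E : measurable E -> nu E \is a fin_num.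
Proof. by []. Qed.

(** Finite additivity is linearity of [L]. For the limit, partial sums of disjoint indicators stay
    in [0, 1], so [functional_cvg] applies with majorant [w]. *)
Lemma functional_charge_sigma_additive : semi_sigma_additive nu.
Proof.
move=> F mF tF mUF.
pose s k x : R := \sum_(0 <= i < k) \1_(F i) x.
have ms k : measurable_fun setT (s k : X -> R).
  by apply: measurable_sum => i; exact: measurable_indic.
have scvg x : s k x @[k --> \oo] --> (\1_(\bigcup_i F i) x : R).
  have := @indic_bigcup _ R F x tF => Ex.
  have : (fun k => \sum_(0 <= i < k) (\1_(F i) x : R)%:E)%E @ \oo
      --> ((\1_(\bigcup_i F i) x)%:E : \bar R).
    rewrite Ex; apply: is_cvg_nneseries => i _ _.
    by rewrite lee_fin indicE ler0n.
  under eq_fun do rewrite sumEFin.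
  by move/fine_cvgP => [_].
have s_ge0 k x : 0 <= s k x by apply: sumr_ge0 => i _; rewrite indicE ler0n.
have s_le1 k x : s k x <= 1.
  apply: (@le_trans _ _ (\1_(\bigcup_i F i) x)); last first.
    by rewrite indicE; case: (_ \in _).
  have nd : nondecreasing_seq (s ^~ x).
    apply/nondecreasing_seqP => j.
    by rewrite /s big_nat_recr//= lerDl indicE ler0n.
  have := nondecreasing_cvgn_le nd (cvgP _ (scvg x)) k.
  by rewrite (cvg_lim _ (scvg x)).
have Vs k : V (fun x => w x * s k x).
  by apply: (@lorentz_weightM _ 1) => // x; rewrite ger0_norm.
have Ls k : L (fun x => w x * s k x) = \sum_(0 <= i < k) L (fun x => w x * \1_(F i) x).
  elim: k => [|k IH].
    rewrite big_geq// (_ : (fun x => _) = (fun=> 0)) ?functional0//.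
    by apply/funext => x; rewrite /s big_geq// mulr0.
  rewrite big_nat_recr//= -IH.
  rewrite -[X in X + _]mul1r -(linL 1 (Vs k) (lorentz_weight_indic (mF k))).
  congr L; apply/funext => x.
  by rewrite /s big_nat_recr//= mulrDr mul1r.
rewrite (_ : (fun k => _) = (fun k => (L (fun x => w x * s k x))%:E)); last first.
  by apply/funext => k; rewrite sumEFin Ls.
apply: cvg_EFin; first exact: nearW.
apply: (functional_cvg (lorentz_weight_indic mUF) lw Vs).
- move=> k x; rewrite -mulrBr normrM ler_piMr//.
  have := s_ge0 k x; have := s_le1 k x; rewrite indicE.
  by case: (_ \in _) => /= s0 s1; rewrite ler_norml; apply/andP; split; lra.
- by move=> x; apply: cvgM; [exact: cvg_cst|exact: scvg].
Qed.

HB.instance Definition _ := isCharge.Build _ X R nu functional_charge0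
  functional_charge_fin functional_charge_sigma_additive.

Lemma lorentz_norm_null f (d : R) : mu [set x | 0 < `|f x|] = 0%E -> 0 < d ->
  (lorentz_norm p q f < d%:E)%E.
Proof.
move=> f0 d0; have l0 : 0 < d / 2 by rewrite divr_gt0.
apply: (@lorentz_norm_ltP _ _ _ _ _ _ (d / 2)); [exact: l0|lra|].
apply: (@le_trans _ _ 0%E); last exact: lee01.
(* The comparison is made with constant 0; 0 times the modular of f is 0 even if that modular is
   infinite. *)
rewrite -(mul0e (lorentz_modular p q f)); apply: (le_modular_ae hp hq (lexx 0)).
apply: aeW => t t0; have qt0 := exponent_gt0 hq t0.
rewrite (_ : rearrangement _ t = 0%E) ?poweR0r ?gt_eqF// ?mul0e//.
apply/eqP; rewrite eq_le rearrangement_ge0 andbT; apply: rearrangement_le => //.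
apply: (@le_trans _ _ 0%E); last by rewrite lee_fin ltW.
rewrite -f0; apply: le_lebesgue_outer => x /=.
rewrite !normr_gt0; apply: contra_neq => ->; exact: mul0r.
Qed.

(** On a null set E, [w] times the indicator has norm below every positive d, so continuity at 0
    forces the value of [L] to be 0. *)
Lemma functional_charge_dominated : nu `<< mu.
Proof.
move=> N muN E mE EN; have muE := muN E mE EN.
rewrite /nu; congr EFin; apply/eqP; rewrite -normr_le0.
apply/ler_addgt0Pr => e e0; rewrite add0r.
have [d d0 dL] := ctsL V0 e0.
have := dL _ (lorentz_weight_indic mE); rewrite functional0 subr0 => wE.
apply/ltW/wE; rewrite (_ : (fun x => _ - 0) = (fun x => w x * \1_E x)); last first.
  by apply/funext => x; rewrite subr0.
apply: lorentz_norm_null d0; apply/eqP; rewrite eq_le; apply/andP; split.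
  rewrite -muE; apply: le_lebesgue_outer => x /=.
  rewrite normr_gt0 indicE; case: (boolP (x \in E)) => [|_].
    by rewrite inE.
  by rewrite mulr0 eqxx.
exact: lebesgue_outer_ge0.
Qed.

(** * The Radon-Nikodym density and bounded multiples of the weight *)

Definition functional_density (x : X) : R :=
  fine (Radon_Nikodym nu mu x).
Local Notation h := functional_density.

(** The derivative is finite at every point, so passing to real values loses nothing. *)
Let hE x : (h x)%:E = Radon_Nikodym nu mu x.
Proof. by rewrite fineK//; apply: Radon_Nikodym_fin_num; exact: functional_charge_dominated. Qed.

Lemma integrable_density : mu.-integrable setT (EFin \o h).
Proof.
apply: eq_integrable (Radon_Nikodym_integrable functional_charge_dominated).
- exact: measurableT.
- by move=> x _; rewrite /= hE.
Qed.

Lemma measurable_density : measurable_fun setT h.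
Proof. by apply/measurable_EFinP; case/integrableP: integrable_density. Qed.

Lemma functional_indic E : measurable E ->
  L (fun x => w x * \1_E x) = \int[mu]_x (\1_E x * h x).
Proof.
move=> mE.
have := Radon_Nikodym_integral functional_charge_dominated mE.
rewrite integral_mkcond /= => nuE.
rewrite /Rintegral -[LHS]/(fine (nu E)) nuE; congr fine.
apply: eq_integral => x _; rewrite patchE indicE.
by case: (x \in E); rewrite ?mul1r ?mul0r// hE.
Qed.

(** The bound on phi puts [w] phi in the space and makes phi [h] integrable; linear combinations
    need both. *)
Definition represented (phi : X -> R) : Prop :=
  [/\ measurable_fun setT phi, exists M, forall x, `|phi x| <= M
    & L (fun x => w x * phi x) = \int[mu]_x (phi x * h x)].

Lemma integrable_bounded_density (phi : X -> R) M : measurable_fun setT phi ->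
  (forall x, `|phi x| <= M) ->
  mu.-integrable setT (EFin \o (fun x => phi x * h x)).
Proof.
move=> mphi phiM.
have iM := integrableZl measurableT M integrable_density.
apply: le_integrable iM; first exact: measurableT.
  by apply/measurable_EFinP; apply: measurable_funM; [exact: mphi|exact: measurable_density].
move=> x _; rewrite /= lee_fin !normrM ler_wpM2r//.
by rewrite (le_trans (phiM x))// ler_norm.
Qed.

Lemma representedD (a : R) (phi psi : X -> R) :
  represented phi -> represented psi ->
  represented (fun x => a * phi x + psi x).
Proof.
move=> [mphi [M phiM] Lphi] [mpsi [N psiN] Lpsi].
have i1 := integrable_bounded_density mphi phiM.
have i2 := integrable_bounded_density mpsi psiN.
split.
- apply: measurable_funD; last exact: mpsi.
  by apply: measurable_funM; [exact: measurable_cst|exact: mphi].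
- exists (`|a| * M + N) => x; apply: le_trans (ler_normD _ _) _.
  by rewrite normrM lerD// ler_wpM2l.
have -> : (fun x => w x * (a * phi x + psi x)) =
    (fun x => a * (w x * phi x) + w x * psi x).
  by apply/funext => x; ring.
rewrite linL; [|exact: lorentz_weightM mphi phiM|exact: lorentz_weightM mpsi psiN].
rewrite Lphi Lpsi -(RintegralZl a measurableT i1) -RintegralD.
- by apply: eq_Rintegral => x _; rewrite mulrDl mulrA.
- exact: measurableT.
- exact: eq_integrable (integrableZl measurableT a i1).
- exact: i2.
Qed.

Lemma represented_indic E : measurable E -> represented \1_E.
Proof.
move=> mE; split; [exact: measurable_indic|by exists 1 => x|].
exact: functional_indic.
Qed.

Lemma represented_sum (r : seq R) (F : R -> set X) :
  (forall y, measurable (F y)) ->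
  represented (fun x => \sum_(y <- r) y * \1_(F y) x).
Proof.
move=> mF; elim: r => [|y r IH].
  rewrite (_ : (fun x => _) = \1_(set0 : set X)).
    exact: represented_indic.
  by apply/funext => x; rewrite big_nil indic0.
rewrite (_ : (fun x => _) =
    (fun x => y * \1_(F y) x + \sum_(y <- r) y * \1_(F y) x)).
  by apply: representedD => //; exact: represented_indic.
by apply/funext => x; rewrite big_cons.
Qed.

Lemma represented_nnsfun (s : {nnsfun X >-> R}) A : measurable A ->
  represented (fun x => s x * \1_A x).
Proof.
move=> mA.
rewrite (_ : (fun x => _) = (fun x => \sum_(y <- finmap.enum_fset (fset_set (range s)))
    y * \1_(s @^-1` [set y] `&` A) x)).
  by apply: represented_sum => y; apply: measurableI.
apply/funext => x; rewrite (fimfunE s) fsbig_finite//= mulr_suml.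
by apply: eq_bigr => y _; rewrite indicI mulrA.
Qed.

Lemma represented_nnsfun_signed (s : {nnsfun X >-> R}) A : measurable A ->
  represented (fun x => s x * signed_indic A x).
Proof.
move=> mA.
rewrite (_ : (fun x => _) =
    (fun x => -1 * (s x * \1_(~` A) x) + s x * \1_A x)).
  by apply: representedD; apply: represented_nnsfun => //; exact: measurableC.
by apply/funext => x; rewrite /signed_indic; ring.
Qed.

(** * Integral representation on the whole space *)

Definition representer (x : X) : R := h x / w x.

Let measurable_weightV : measurable_fun setT (fun x : X => (w x)^-1).
Proof.
have mwV := measurableT_comp (@measurable_powR R (-1)) (@measurable_weight R n).
apply: eq_measurable_fun mwV => x _ /=.
by rewrite powR_inv1// ltW// weight_gt0.
Qed.

Lemma measurable_representer : measurable_fun setT representer.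
Proof. by apply: measurable_funM; [exact: measurable_density|exact: measurable_weightV]. Qed.

(** The majorant is f itself: from 0 <= w s_k <= f the error f - w s_k lies between 0 and f, and the
    sign does not affect its absolute value. *)
Lemma functional_signed_cvg f (s : nat -> {nnsfun X >-> R}) A : V f ->
  (forall x, 0 <= f x) -> measurable A ->
  (forall k x, s k x <= f x / w x) ->
  (forall x, s k x @[k --> \oo] --> f x / w x) ->
  L (fun x => w x * (s k x * signed_indic A x)) @[k --> \oo] -->
  L (fun x => f x * signed_indic A x).
Proof.
move=> lf f0 mA sle scv.
have wn0 (x : X) : w x != 0 by rewrite gt_eqF// weight_gt0.
have Vf : V (fun x => f x * signed_indic A x).
  apply: (lorentz_ideal hp hq ltr01 lf).
    apply: measurable_funM; [exact: lorentz_measurable lf|].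
    exact: measurable_signed_indic.
  by move=> x; rewrite normrM norm_signed_indic mulr1 mul1r.
apply: (functional_cvg Vf lf).
- move=> k; have [ms [M sM] _] := represented_nnsfun_signed (s k) mA.
  exact: lorentz_weightM ms sM.
- move=> k x; rewrite mulrA -mulrBl normrM norm_signed_indic mulr1.
  rewrite distrC ger0_norm; last first.
    by rewrite subr_ge0 mulrC -ler_pdivlMr// weight_gt0.
  rewrite ger0_norm// gerBl mulr_ge0//.
  by rewrite ltW// weight_gt0.
- move=> x; rewrite (_ : f x = w x * (f x / w x)); last by rewrite mulrC divfK.
  rewrite -mulrA; apply: cvgM; first exact: cvg_cst.
  by apply: cvgM; [exact: scv|exact: cvg_cst].
Qed.

Lemma functional_representer_ge0 f : V f -> (forall x, 0 <= f x) ->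
  mu.-integrable setT (EFin \o (fun x => f x * representer x)) /\
  L f = \int[mu]_x (f x * representer x).
Proof.
move=> lf f0; have mf := lorentz_measurable lf.
pose phi x := f x / w x.
have phi0 x : 0 <= phi x by rewrite divr_ge0// ltW// weight_gt0.
have mphi : measurable_fun setT phi.
  by apply: measurable_funM; [exact: mf|exact: measurable_weightV].
have mh := measurable_density.
have Emphi : measurable_fun setT (EFin \o phi) by exact/measurable_EFinP.
have [s [nds cvs]] := approximation measurableT Emphi (fun x _ => phi0 x).
have scv x : s k x @[k --> \oo] --> phi x.
  by have /fine_cvgP[] := cvs x I.
have ndsx x : nondecreasing_seq (fun k => s k x).
  by move=> i j ij; have /lefP := nds i j ij; exact.
have sle k x : s k x <= phi x.
  have := nondecreasing_cvgn_le (ndsx x) (cvgP _ (scv x)) k.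
  by rewrite (cvg_lim _ (scv x)).
have gE x : f x * representer x = phi x * h x.
  by rewrite /representer /phi mulrA mulrAC.
have mms k : measurable_fun setT (s k) by exact: measurable_funP.
(* Convergence of the signed integrals of s_k h would give no integrability. With the sign of [h]
   inserted, the integrands s_k |h| increase, and the limit of their integrals is a value of [L],
   hence finite. *)
pose A := [set x | 0 <= h x].
have mA : measurable A by exact: measurable_nonneg.
have absE (u : X -> R) x : u x * signed_indic A x * h x = u x * `|h x|.
  by rewrite -mulrA (mulrC (signed_indic _ _)) mul_signed_indic.
have mabs : measurable_fun setT (fun x => `|h x|).
  by apply: measurableT_comp; [exact: normr_measurable|exact: mh].
have cvgA := functional_signed_cvg lf f0 mA sle scv.
have intA k : (\int[mu]_x (s k x * `|h x|)%:E =
    (L (fun x => w x * (s k x * signed_indic A x)))%:E)%E.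
  have [ms [M sM] ->] := represented_nnsfun_signed (s k) mA.
  have ish := integrable_bounded_density ms sM.
  rewrite /Rintegral fineK; last by apply: integrable_fin_num ish.
  by apply: eq_integral => x _; rewrite absE.
have intphi : (\int[mu]_x (phi x * `|h x|)%:E =
    (L (fun x => f x * signed_indic A x))%:E)%E.
  have mono := @cvg_monotone_convergence _ X R mu setT measurableT
    (fun k x => (s k x * `|h x|)%:E) _ _ _.
  have c1 : (\int[mu]_x (s k x * `|h x|)%:E)%E @[k --> \oo] -->
      (\int[mu]_x (phi x * `|h x|)%:E)%E.
    rewrite (_ : (\int[mu]_x (phi x * `|h x|)%:E)%E = (\int[mu]_x
        (fun x => limn (fun k => (s k x * `|h x|)%:E)) x)%E); last first.
      apply: eq_integral => x _; apply/esym/cvg_lim => //.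
      apply: cvg_EFin; first exact: nearW.
      by apply: cvgM; [exact: scv|exact: cvg_cst].
    apply: mono.
    - by move=> k; apply/measurable_EFinP; apply: measurable_funM.
    - by move=> k x _; rewrite lee_fin mulr_ge0.
    - by move=> x _ i j ij; rewrite lee_fin ler_wpM2r// ndsx.
  have c2 : (\int[mu]_x (s k x * `|h x|)%:E)%E @[k --> \oo] -->
      (L (fun x => f x * signed_indic A x))%:E.
    by under eq_fun do rewrite intA; apply: cvg_EFin; [exact: nearW|exact: cvgA].
  exact: cvg_unique c1 c2.
have iphi : mu.-integrable setT (EFin \o (fun x => phi x * h x)).
  apply/integrableP; split.
    by apply/measurable_EFinP; apply: measurable_funM.
  rewrite (_ : (\int[mu]_x _)%E = (\int[mu]_x (phi x * `|h x|)%:E)%E).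
    by rewrite intphi ltry.
  by apply: eq_integral => x _; rewrite /= normrM ger0_norm.
have iabs : mu.-integrable setT (fun x => (phi x * `|h x|)%:E).
  apply: le_integrable iphi; first exact: measurableT.
    by apply/measurable_EFinP; apply: measurable_funM.
  by move=> x _; rewrite /= lee_fin !normrM normr_id.
split.
  apply: eq_integrable iphi; first exact: measurableT.
  by move=> x _; rewrite /= gE.
(* The argument is repeated with constant sign 1: phi |h|, now known to be integrable, is the
   majorant for dominated convergence. *)
have sT x : signed_indic setT x = 1 by rewrite signed_indicE in_setT.
have cvgT := functional_signed_cvg lf f0 measurableT sle scv.
have LT : L (fun x => f x * signed_indic setT x) = L f.
  by congr L; apply/funext => x; rewrite sT mulr1.
rewrite LT in cvgT.
have intT k : (L (fun x => w x * (s k x * signed_indic setT x)))%:E =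
    (\int[mu]_x (s k x * h x)%:E)%E.
  have [ms [M sM] ->] := represented_nnsfun_signed (s k) measurableT.
  have ish := integrable_bounded_density ms sM.
  rewrite /Rintegral fineK; last by apply: integrable_fin_num ish.
  by apply: eq_integral => x _; rewrite sT mulr1.
have [] := @dominated_convergence _ X R mu setT measurableT
  (fun k x => (s k x * h x)%:E) (fun x => (phi x * h x)%:E)
  (fun x => (phi x * `|h x|)%:E).
- by move=> k; apply/measurable_EFinP; apply: measurable_funM.
- by apply/measurable_EFinP; apply: measurable_funM.
- apply: aeW => x _; apply: cvg_EFin; first exact: nearW.
  by apply: cvgM; [exact: scv|exact: cvg_cst].
- exact: iabs.
- by apply: aeW => x k _; rewrite lee_fin normrM ger0_norm// ler_wpM2r.
move=> _ _ dom.
have c2 : (\int[mu]_x (s k x * h x)%:E)%E @[k --> \oo] --> (L f)%:E.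
  by under eq_fun do rewrite -intT; apply: cvg_EFin; [exact: nearW|exact: cvgT].
have LE : (\int[mu]_x (phi x * h x)%:E = (L f)%:E)%E by exact: cvg_unique dom c2.
rewrite -[LHS]/(fine (L f)%:E) -LE; congr fine.
by apply: eq_integral => x _; rewrite gE.
Qed.

Lemma functional_representer f : V f ->
  mu.-integrable setT (EFin \o (fun x => f x * representer x)) /\
  L f = pairing representer f.
Proof.
move=> lf; have mf := lorentz_measurable lf.
pose fp x := Num.max (f x) 0; pose fn x := Num.max (- f x) 0.
have fE : f = (fun x => -1 * fn x + fp x).
  apply/funext => x; rewrite /fp /fn /Num.max.
  by repeat case: ifPn; rewrite -?leNgt => *; lra.
have Vp : V fp.
  apply: (lorentz_ideal hp hq ltr01 lf).
    by apply: measurable_maxr; [exact: mf|exact: measurable_cst].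
  by move=> x; rewrite mul1r /fp /Num.max; case: ifPn => _ //; rewrite normr0.
have Vn : V fn.
  apply: (lorentz_ideal hp hq ltr01 lf).
    by apply: measurable_maxr; [exact: measurableT_comp mf|exact: measurable_cst].
  by move=> x; rewrite mul1r /fn /Num.max; case: ifPn => _ //;
    rewrite ?normrN ?normr0.
have p0 x : 0 <= fp x by rewrite le_max lexx orbT.
have n0 x : 0 <= fn x by rewrite le_max lexx orbT.
have [ip Lp] := functional_representer_ge0 Vp p0.
have [iN LN] := functional_representer_ge0 Vn n0.
have iN' := integrableZl measurableT (-1) iN.
have fgE x : f x * representer x =
    -1 * (fn x * representer x) + fp x * representer x.
  by rewrite [in LHS]fE; ring.
split.
  apply: eq_integrable (integrableD measurableT iN' ip); first exact: measurableT.
  by move=> x _; rewrite /= fgE.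
rewrite [in LHS]fE (linL _ Vn Vp) LN Lp /pairing.
rewrite -(RintegralZl (-1) measurableT iN) -RintegralD.
- by apply: eq_Rintegral => x _; rewrite fgE.
- exact: measurableT.
- exact: eq_integrable iN'.
- exact: ip.
Qed.

(** For f in the unit ball, the integral of |f| times the absolute value of the representer is [L]
    at a twist of f of the same norm, so the bound of [L] on the ball applies. *)
Lemma koethe_representer : koethe_dual p q representer.
Proof.
split; first exact: measurable_representer.
have [M M0 LM] := functional_bounded.
apply: (@le_lt_trans _ _ M%:E); last exact: ltry.
apply: ge_ereal_sup => _ [f [lf f1] <-].
have [f' [lf' f'1 f'E _]] := lorentz_twist hp hq lf measurable_representer.
have [iF LF] := functional_representer lf'.
rewrite Lnorm1 (_ : (\int[mu]_x _)%E = (L f')%:E).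
  rewrite lee_fin; apply: (le_trans (ler_norm _)); apply: LM; first exact: lf'.
  by rewrite f'1; exact: f1.
rewrite LF /pairing /Rintegral fineK; last by apply: integrable_fin_num iF.
by apply: eq_integral => x _; rewrite f'E /= mulrC.
Qed.

End representation.

Unset Implicit Arguments.

(* The Euclidean space [euclid R n] has dimension n.+1. *)
Theorem proposition17 (R : realType) (n : nat) (p q : R -> R)
    (hp : exponentP1 p) (hq : exponentP1 q)
    (h0 : exponent0 q <= exponent0 p) (hy : exponenty p <= exponenty q) :
  exists T : (euclid R n -> R) -> ((euclid R n -> R) -> R),
    koethe_dual_isomorphism p q T.
Proof.
exists (@pairing R n); split.
- by move=> g Kg; split; [exact: pairing_linear|exact: pairing_continuous].
- exact: pairing_linear_l.
- exact: pairing_inj.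
- move=> L [linL ctsL]; exists (representer hp hq linL ctsL).
    exact: koethe_representer.
  by move=> f lf; have [_ ->] := functional_representer hp hq linL ctsL lf.
- by exists 1 => // g Kg; rewrite mul1e; exact: pairing_dual_norm_le.
- by exists 1 => // g Kg; rewrite mul1e; exact: koethe_norm_le_dual.
Qed.
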